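(* Let $d\ge2$, $\omega\in\mathbb{S}^{d-1}$, $k\in\mathbb{R}^d$, $|k|=\kappa>0$, $\alpha<0$, $\sin\alpha\ne0$. Let $\psi_0(x)=e^{ikx}$ and let $\psi_1$ be a radiation solution of $-\Delta\psi=\kappa^2\psi$ in $\mathcal{U}$ with far-field pattern $f_1$. Then for $\theta\in\mathbb{S}^+_\omega$, $$f_1(\theta)=f_{1,1}(\theta)+\frac{1}{2i\sin\alpha}\,\mathcal{O}\left(\frac{1}{|x|^{1/2}}\right)\quad\text{as }|x|\to+\infty,$$ where $f_{1,1}(\theta)$ is computed from the points $x=r\theta$, $r=|x|$, and $y=x+\zeta$, with $\zeta$ chosen as $$\zeta=-\beta\frac{\kappa\theta_{||}-k_{||}}{|\kappa\theta_{||}-k_{||}|},\quad \hat\zeta=-\operatorname{sgn}\beta\,\frac{\kappa\theta_{||}-k_{||}}{|\kappa\theta_{||}-k_{||}|}\quad\text{if }\kappa\theta_{||}\ne k_{||},$$ $$\zeta=\beta\hat\zeta,\quad\hat\zeta\in X_{0,\omega},\quad|\hat\zeta|=1\quad\text{if }\kappa\theta_{||}=k_{||},$$ $$\beta=\frac{2\alpha}{|k_{||}-\kappa\theta_{||}|+\sqrt{|k_{||}-\kappa\theta_{||}|^2+\frac{2\kappa}{r}\left((\theta_{||},\hat\zeta)^2-1\right)\alpha}}.$$ In addition, this estimate holds uniformly in $\theta\in\mathbb{S}^+_{\omega,\delta}$ for fixed $\delta\in(0,1)$.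
   Context: $\mathcal{U}=\mathbb{R}^d\setminus(\Omega\cup\partial\Omega)$ is connected, where $\Omega\subset\mathbb{R}^d$ is a bounded open domain with smooth boundary. For vectors, $kx=(k,x)$ denotes the Euclidean scalar product. A radiation solution is a $C^2$ solution $\psi_1$ of $-\Delta\psi_1=\kappa^2\psi_1$ in $\mathcal{U}$ satisfying $|x|^{\frac{d-1}{2}}\left(\frac{\partial}{\partial|x|}-i\kappa\right)\psi_1(x)\to0$ as $|x|\to+\infty$, uniformly in $x/|x|$. Its far-field pattern is the function $f_1$ on $\mathbb{S}^{d-1}$ such that $\psi_1(x)=\frac{e^{i\kappa|x|}}{|x|^{(d-1)/2}}f_1\left(\frac{x}{|x|}\right)+\mathcal{O}\left(|x|^{-(d+1)/2}\right)$ as $|x|\to+\infty$. For $s\ge0$: $X_{s,\omega}=\{x\in\mathbb{R}^d:(x,\omega)=s\}$; $\mathbb{S}^+_\omega=\{\theta\in\mathbb{S}^{d-1}:(\theta,\omega)>0\}$. Decompose $\theta=\theta_\perp+\theta_{||}$, $k=k_\perp+k_{||}$ with $\theta_\perp,k_\perp$ orthogonal to $X_{0,\omega}$ and $\theta_{||},k_{||}\in X_{0,\omega}$. For $\delta\in(0,1)$, $\mathbb{S}^+_{\omega,\delta}=\{\theta\in\mathbb{S}^+_\omega:|\theta_{||}|<\delta\}$. Since $\beta$ depends on $\hat\zeta$ only through $(\theta_{||},\hat\zeta)^2$, the choice of $\zeta,\hat\zeta,\beta$ is consistent; when $\kappa\theta_{||}=k_{||}$, $\hat\zeta$ is any unit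 vector of $X_{0,\omega}$. Both points lie in the same hyperplane: $x=\frac{s\theta}{(\theta,\omega)}\in X_{s,\omega}$ with $s=r(\theta,\omega)$, and $y=x+\zeta\in X_{s,\omega}$. Define $a(x,k)=|x|^{(d-1)/2}\left(|\psi_0(x)+\psi_1(x)|^2-1\right)$, $x\in\mathcal{U}$, and $$f_{1,1}(\theta)=\frac1D\left(e^{i(ky-|k||y|)}a(x,k)-e^{i(kx-|k||x|)}a(y,k)\right),\qquad D=2i\sin\big(k\zeta+|k||x|-|k||y|\big).$$ So $f_{1,1}(\theta)$ depends also on $x$ (and $k,\alpha,\omega$). The quantities $\omega,k,\alpha$ are fixed in the limit $|x|\to+\infty$. *)

(* Defs.v *)
From HB Require Import structures.
From mathcomp Require Export all_boot all_order all_algebra.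
From mathcomp Require Export complex.
From mathcomp Require Export all_classical all_reals all_analysis.
Export Order.TTheory GRing.Theory Num.Theory numFieldNormedType.Exports.

Set Implicit Arguments.
Unset Strict Implicit.
Unset Printing Implicit Defensive.

Local Open Scope classical_set_scope.
Local Open Scope ring_scope.
Local Open Scope complex_scope.

Section Euclidean.
Variables (R : realType) (d : nat).
Implicit Types (x y u w theta : 'rV[R]_d) (s delta : R).

Definition dot x y : R := \sum_(i < d) x 0 i * y 0 i.

(* The library norm on 'rV[R]_d is the sup norm; it induces the same topology
   and the same bounded sets as this one. *)
Definition enorm x : R := Num.sqrt (dot x x).

Definition direction x : 'rV[R]_d := (enorm x)^-1 *: x.

Definition sphere : set 'rV[R]_d := [set x | enorm x = 1].

Definition hyperplane w s : set 'rV[R]_d := [set x | dot x w = s].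

Definition half_sphere w : set 'rV[R]_d :=
  [set theta | sphere theta /\ 0 < dot theta w].

Definition perp_part w u : 'rV[R]_d := dot u w *: w.
Definition par_part w u : 'rV[R]_d := u - perp_part w u.

Definition half_sphere_lt w delta : set 'rV[R]_d :=
  [set theta | half_sphere w theta /\ enorm (par_part w theta) < delta].

Lemma dotC x y : dot x y = dot y x.
Proof. by apply: eq_bigr => i _; rewrite mulrC. Qed.

Lemma dotDl x y u : dot (x + y) u = dot x u + dot y u.
Proof. by rewrite -big_split /=; apply: eq_bigr => i _; rewrite mxE mulrDl. Qed.

Lemma dotZl (c : R) x u : dot (c *: x) u = c * dot x u.
Proof. by rewrite mulr_sumr; apply: eq_bigr => i _; rewrite mxE mulrA. Qed.

Lemma dotxx_ge0 x : 0 <= dot x x.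
Proof. by apply: sumr_ge0 => i _; rewrite -expr2 sqr_ge0. Qed.

Lemma dot_sphere w : sphere w -> dot w w = 1.
Proof. by move=> w1; rewrite -(sqr_sqrtr (dotxx_ge0 w)) [Num.sqrt _]w1 expr1n. Qed.

Lemma dotxx_eq0 x : dot x x = 0 -> x = 0.
Proof.
move/eqP; rewrite psumr_eq0; last by move=> i _; rewrite -expr2 sqr_ge0.
move=> /allP x0; apply/rowP => i; rewrite mxE.
by have := x0 i (mem_index_enum i); rewrite mulf_eq0 orbb => /eqP.
Qed.

(* For a unit vector w, u = perp_part w u + par_part w u is the only
   decomposition of u into a vector orthogonal to the hyperplane
   hyperplane w 0 and a vector of that hyperplane. *)
Lemma perp_parP w u p q : sphere w ->
  [/\ u = p + q, forall z, hyperplane w 0 z -> dot p z = 0 & hyperplane w 0 q]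
  <-> p = perp_part w u /\ q = par_part w u.
Proof.
move=> /dot_sphere w1.
have perp z : hyperplane w 0 z -> dot w z = 0 by rewrite dotC.
have parX z : hyperplane w 0 (par_part w z).
  by rewrite /hyperplane /par_part /perp_part /= dotDl -scaleNr dotZl w1 mulr1 subrr.
split=> [[-> pP qX]|[-> ->]]; last first.
  split=> //; first by rewrite addrC subrK.
  by move=> z zX; rewrite dotZl perp// mulr0.
have pw : p = dot p w *: w.
  apply/eqP; rewrite -subr_eq0; apply/eqP/dotxx_eq0.
  have := parX p; rewrite /par_part /perp_part => pX.
  rewrite [X in dot X _]/(_ - _) dotDl pP// add0r -scaleNr dotZl.
  by rewrite perp ?mulr0// scaleNr.
have Ep : perp_part w (p + q) = p.
  by rewrite /perp_part dotDl (qX : dot q w = 0) addr0 -pw.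
by rewrite /par_part Ep addrAC subrr add0r.
Qed.

End Euclidean.

Section Smoothness.
Variables (R : realType) (d : nat).
Implicit Types (V Omega : set 'rV[R]_d) (f : 'rV[R]_d -> R).
Implicit Types (psi : 'rV[R]_d -> R[i]).

Definition partial (i : 'I_d) f : 'rV[R]_d -> R := 'D_'e_i f.

(* f is of class C^n on the open set V. *)
Fixpoint class_C (n : nat) V f : Prop :=
  {in V, continuous f} /\
  if n is m.+1 then
    forall i : 'I_d,
      (forall x, V x -> derivable f x 'e_i) /\
      class_C m V (partial i f)
  else True.

Definition boundary Omega : set 'rV[R]_d := closure Omega `\` interior Omega.

(* Near each boundary point, Omega is the set where a smooth function without
   critical points is negative. *)
Definition smooth_boundary Omega : Prop :=
  forall p, boundary Omega p ->
    exists V rho, [/\ open V, V p, forall n, class_C n V rho,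
      forall x, V x -> exists i : 'I_d, partial i rho x != 0 &
      forall x, V x -> (Omega x <-> rho x < 0) /\
                       (boundary Omega x <-> rho x = 0)].

Definition smooth_bounded_domain Omega : Prop :=
  [/\ open Omega, Omega !=set0, connected Omega, bounded_set Omega &
      smooth_boundary Omega].

Definition exterior Omega : set 'rV[R]_d := ~` (Omega `|` boundary Omega).

(* Complex-valued functions are differentiated componentwise. *)
Definition class_Cc (n : nat) V psi : Prop :=
  class_C n V (fun x => complex.Re (psi x)) /\
  class_C n V (fun x => complex.Im (psi x)).

Definition derivec (v : 'rV[R]_d) psi (x : 'rV[R]_d) : R[i] :=
  'D_v (fun y => complex.Re (psi y)) x +i* 'D_v (fun y => complex.Im (psi y)) x.

Definition partialc (i : 'I_d) psi : 'rV[R]_d -> R[i] :=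
  derivec 'e_i psi.

Definition laplacian psi (x : 'rV[R]_d) : R[i] :=
  \sum_(i < d) partialc i (partialc i psi) x.

End Smoothness.

Section Scattering.
Variables (R : realType) (d : nat).
Implicit Types (x y k w theta zeta zetah : 'rV[R]_d) (kappa alpha beta r : R).
Implicit Types (U : set 'rV[R]_d) (psi f : 'rV[R]_d -> R[i]).

Definition cis (t : R) : R[i] := cos t +i* sin t.

Definition plane_wave k x : R[i] := cis (dot k x).

(* The derivative in the direction of x is the derivative in |x|. Note that
   the order on R[i] requires both sides of an inequality to have the same
   imaginary part, which is 0 in the inequalities below. *)
Definition radiation_condition U kappa psi : Prop :=
  forall e : R, 0 < e -> exists r0 : R, forall x, U x -> r0 <= enorm x ->
    `| (enorm x `^ ((d%:R - 1) / 2))%:C *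
       (derivec (direction x) psi x - (kappa *i)%C * psi x) | < e%:C.

Definition radiation_solution U kappa psi : Prop :=
  [/\ class_Cc 2 U psi,
      forall x, U x -> - laplacian psi x = (kappa ^+ 2)%:C * psi x &
      radiation_condition U kappa psi].

(* Only the values of f on the unit sphere matter. *)
Definition far_field_pattern U kappa psi f : Prop :=
  exists c r0 : R, 0 < r0 /\ forall x, U x -> r0 <= enorm x ->
    `| psi x -
       cis (kappa * enorm x) / (enorm x `^ ((d%:R - 1) / 2))%:C *
       f (direction x) | <= (c * enorm x `^ (- ((d%:R + 1) / 2)))%:C.

Definition intensity psi k x : R[i] :=
  (enorm x `^ ((d%:R - 1) / 2))%:C * (`| plane_wave k x + psi x | ^+ 2 - 1).

Definition two_point_det k x zeta : R[i] :=
  2 * 'i%C *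
  (sin (dot k zeta + enorm k * enorm x - enorm k * enorm (x + zeta)))%:C.

Definition f11 psi k x zeta : R[i] :=
  let y := x + zeta in
  (two_point_det k x zeta)^-1 *
  (cis (dot k y - enorm k * enorm y) * intensity psi k x -
   cis (dot k x - enorm k * enorm x) * intensity psi k y).

(* A relation rather than a function: the formulas are implicit, since beta is
   given in terms of zetah and zetah in terms of the sign of beta, and when
   kappa *: par_part w theta = par_part w k the unit vector zetah is
   arbitrary in the hyperplane. *)
Definition shift_choice kappa k w alpha r theta zeta zetah beta : Prop :=
  let tpar := par_part w theta in
  let kpar := par_part w k in
  let v := kappa *: tpar - kpar in
  [/\ kappa *: tpar <> kpar ->
        zeta = - beta *: direction v /\
        zetah = - Num.sg beta *: direction v,
      kappa *: tpar = kpar ->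
        [/\ zeta = beta *: zetah, hyperplane w 0 zetah & enorm zetah = 1] &
      beta = 2 * alpha /
        (enorm (kpar - kappa *: tpar) +
         Num.sqrt (enorm (kpar - kappa *: tpar) ^+ 2 +
           2 * kappa / r * (dot tpar zetah ^+ 2 - 1) * alpha))].

Lemma hyperplane_unit w : (2 <= d)%N ->
  exists z : 'rV[R]_d, hyperplane w 0 z /\ enorm z = 1.
Proof.
move=> d2; pose K := kermx w^T.
have K0 : K != 0.
  rewrite -mxrank_eq0 mxrank_ker subn_eq0 -ltnNge.
  by rewrite (leq_ltn_trans (rank_leq_col _)).
pose u := nz_row K.
have u0 : u != 0 by rewrite nz_row_eq0.
have uw : dot u w = 0.
  have /sub_kermxP /matrixP/(_ 0 0) : (u <= K)%MS by exact: nz_row_sub.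
  by rewrite !mxE => uw; rewrite -[RHS]uw; apply: eq_bigr => i _; rewrite mxE.
have nu : enorm u != 0.
  rewrite sqrtr_eq0 -ltNge lt_def dotxx_ge0 andbT.
  by apply: contra u0 => /eqP/dotxx_eq0 ->.
exists (direction u); split; first by rewrite /hyperplane /= dotZl uw mulr0.
rewrite /enorm dotZl dotC dotZl -[dot u u]sqr_sqrtr ?dotxx_ge0//.
by rewrite -/(enorm u) expr2 (mulKf nu) mulVf// sqrtr1.
Qed.

(* The implicit relation can always be solved. *)
Lemma shift_choice_exists kappa k w alpha r theta :
  (2 <= d)%N -> alpha < 0 ->
  exists zeta zetah beta, shift_choice kappa k w alpha r theta zeta zetah beta.
Proof.
move=> d2 a0; pose v := kappa *: par_part w theta - par_part w k.
pose b (z : 'rV[R]_d) := 2 * alpha /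
  (enorm (par_part w k - kappa *: par_part w theta) +
   Num.sqrt (enorm (par_part w k - kappa *: par_part w theta) ^+ 2 +
     2 * kappa / r * (dot (par_part w theta) z ^+ 2 - 1) * alpha)).
have [e|/eqP ne] := eqVneq (kappa *: par_part w theta) (par_part w k).
  have [z [zX z1]] := hyperplane_unit w d2.
  by exists (b z *: z), z, (b z); split.
exists (- b (direction v) *: direction v), (direction v), (b (direction v)).
split=> // _; split=> //.
suff b0 : b (direction v) < 0 by rewrite ltr0_sg// opprK scale1r.
rewrite /b nmulr_rlt0 ?pmulr_rlt0// invr_gt0 ltr_wpDr ?sqrtr_ge0//.
rewrite sqrtr_gt0 lt_def dotxx_ge0 andbT; apply/eqP => /dotxx_eq0/eqP.
by rewrite subr_eq0 => /eqP/esym.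
Qed.

(* f theta = f11 + O(r^(-1/2)) / (2 i sin alpha) as r = |x| -> +oo, with
   x = r *: theta, uniformly for theta in A and over all admissible shifts. *)
Definition f11_estimate kappa k w alpha psi f (A : set 'rV[R]_d) : Prop :=
  exists c r0 : R, 0 < r0 /\
    forall theta r zeta zetah beta, A theta -> r0 <= r ->
      shift_choice kappa k w alpha r theta zeta zetah beta ->
      exists rem : R[i],
        `| rem | <= (c * r `^ (- (1 / 2)))%:C /\
        f theta = f11 psi k (r *: theta) zeta +
                  (2 * 'i%C * (sin alpha)%:C)^-1 * rem.

End Scattering.

(* Main.v *)
From HB Require Import structures.
Require Import Defs.
From mathcomp Require Import ring lra.


(* The far-field pattern f is only known to be the uniform limit, with rate 1/r,
   of g(r, theta) = r^((d-1)/2) e^(-i kappa r) psi(r theta), but the estimate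
   needs f to be Lipschitz: |zeta| may be of order r^(1/2), so that the
   directions of x and y differ by O(r^(-1/2)).

   Regularity of f. The Helmholtz equation reads
     r^2 g_rr + 2 i kappa r^2 g_r - (m^2 - m) g = - L g,   m = (d-1)/2,
   with L the Laplacian of the sphere. Average g over r in [rho, 2 rho] against
   a bump function of r and integrate by parts in r: since the radial terms
   annihilate f up to lower order and g - f = O(1/r), the average G of g has
   L G bounded independently of rho. The maximum principle on a half sphere,
   applied to G minus its reflection in the boundary hyperplane and to a
   quadratic barrier, turns the bound on L G into a Lipschitz bound on G, and
   rho -> oo gives the Lipschitz bound on f. The averages are Riemann sums, so
   that G is a finite sum of C^2 functions; integration by parts is then the mean
   value theorem on each mesh interval.

   Two points. beta solves A beta - q beta^2 = alpha, which makes the phase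
   k zeta + kappa |x| - kappa |y| equal to alpha + O(r^(-1/2)); the linear system
   formed by the expansions of a(x, k) and a(y, k) in f and its conjugate then has
   determinant close to 2 i sin alpha. *)

Set Implicit Arguments.
Unset Strict Implicit.
Unset Printing Implicit Defensive.

Local Open Scope classical_set_scope.
Local Open Scope ring_scope.

(** * Euclidean geometry and continuity *)

Lemma cvg_sum (R : numFieldType) (V : normedModType R) (T : Type) (I : finType)
    (F : set_system T) (f : I -> T -> V) (l : I -> V) : Filter F ->
  (forall i, f i x @[x --> F] --> l i) ->
  \sum_i f i x @[x --> F] --> \sum_i l i.
Proof.
move=> FF fl.
exact: (@cvg_big V I +%R 0 xpredT add_continuous T F _ _ _ FF (fun i _ => fl i)).
Qed.

Section ContinuousAt.
Variables (R : realType) (T : topologicalType) (x : T).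

Lemma continuous_atD (V : normedModType R) (f g : T -> V) :
  continuous_at x f -> continuous_at x g ->
  continuous_at x (fun y => f y + g y).
Proof. by move=> fx gx; exact: cvgD. Qed.

Lemma continuous_atB (V : normedModType R) (f g : T -> V) :
  continuous_at x f -> continuous_at x g ->
  continuous_at x (fun y => f y - g y).
Proof. by move=> fx gx; exact: cvgB. Qed.

Lemma continuous_atM (f g : T -> R) :
  continuous_at x f -> continuous_at x g ->
  continuous_at x (fun y => f y * g y).
Proof. by move=> fx gx; exact: cvgM. Qed.

Lemma continuous_atMl (c : R) (f : T -> R) :
  continuous_at x f -> continuous_at x (fun y => c * f y).
Proof. by move=> fx; apply: continuous_atM => //; exact: cst_continuous. Qed.

Lemma continuous_atZ (V : normedModType R) (f : T -> R) (v : V) :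
  continuous_at x f -> continuous_at x (fun y => f y *: v).
Proof. by move=> fx; exact: cvgZr_tmp. Qed.

Lemma continuous_atV (f : T -> R) : f x != 0 ->
  continuous_at x f -> continuous_at x (fun y => (f y)^-1).
Proof. by move=> fx0 fx; exact: cvgV. Qed.

Lemma continuous_at_sum (V : normedModType R) (I : finType) (f : I -> T -> V) :
  (forall i, continuous_at x (f i)) ->
  continuous_at x (fun y => \sum_i f i y).
Proof. by move=> fx; exact: cvg_sum. Qed.

End ContinuousAt.

Section EuclideanFacts.
Variables (R : realType) (d : nat).
Implicit Types (x y z : 'rV[R]_d).

Lemma dotDr x y z : dot x (y + z) = dot x y + dot x z.
Proof. by rewrite dotC dotDl !(dotC _ x). Qed.

Lemma dotZr (c : R) x y : dot x (c *: y) = c * dot x y.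
Proof. by rewrite dotC dotZl dotC. Qed.

Lemma dotNl x y : dot (- x) y = - dot x y.
Proof. by rewrite -scaleN1r dotZl mulN1r. Qed.

Lemma dotNr x y : dot x (- y) = - dot x y.
Proof. by rewrite dotC dotNl dotC. Qed.

Lemma dotBl x y z : dot (x - y) z = dot x z - dot y z.
Proof. by rewrite dotDl dotNl. Qed.

Lemma dotBr x y z : dot x (y - z) = dot x y - dot x z.
Proof. by rewrite dotDr dotNr. Qed.

Lemma dot0l x : dot 0 x = 0.
Proof. by rewrite -(scale0r 0) dotZl mul0r. Qed.

Lemma dot0r x : dot x 0 = 0.
Proof. by rewrite dotC dot0l. Qed.

Lemma dot_deltal (i : 'I_d) x : dot 'e_i x = x 0 i.
Proof.
rewrite /dot (bigD1 i)//= big1 ?addr0; last first.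
  by move=> j ji; rewrite mxE eqxx (negbTE ji) mul0r.
by rewrite mxE !eqxx mul1r.
Qed.

Lemma dot_deltar (i : 'I_d) x : dot x 'e_i = x 0 i.
Proof. by rewrite dotC dot_deltal. Qed.

Lemma sqr_enorm x : enorm x ^+ 2 = dot x x.
Proof. by rewrite sqr_sqrtr ?dotxx_ge0. Qed.

Lemma enorm_ge0 x : 0 <= enorm x.
Proof. exact: sqrtr_ge0. Qed.

Lemma enormZ (c : R) x : enorm (c *: x) = `|c| * enorm x.
Proof.
by rewrite /enorm dotZl dotZr mulrA -expr2 sqrtrM ?sqr_ge0// sqrtr_sqr.
Qed.

Lemma enormN x : enorm (- x) = enorm x.
Proof. by rewrite -scaleN1r enormZ normrN1 mul1r. Qed.

Lemma enorm_eq0 x : enorm x = 0 -> x = 0.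
Proof. by move=> x0; apply: dotxx_eq0; rewrite -sqr_enorm x0 expr0n. Qed.

Lemma enorm_gt0 x : x != 0 -> 0 < enorm x.
Proof.
by move=> x0; rewrite lt_def enorm_ge0 andbT; apply: contra x0 => /eqP/enorm_eq0 ->.
Qed.

Lemma enorm_direction x : x != 0 -> enorm (direction x) = 1.
Proof.
move=> x0; have n0 := enorm_gt0 x0.
by rewrite enormZ ger0_norm ?invr_ge0 ?enorm_ge0// mulVf// gt_eqF.
Qed.

Lemma enormZ_sphere (c : R) x : 0 <= c -> sphere x -> enorm (c *: x) = c.
Proof. by move=> c0 x1; rewrite enormZ ger0_norm// [enorm x]x1 mulr1. Qed.

Lemma direction_ray (r : R) x : 0 < r -> sphere x -> direction (r *: x) = x.
Proof.
move=> r0 x1; rewrite /direction enormZ_sphere ?(ltW r0)// scalerA mulVf ?scale1r//.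
by rewrite gt_eqF.
Qed.

(** Cauchy-Schwarz: the square of [enorm y *: x - enorm x *: y] is nonnegative, and its expansion
    can be divided by [enorm x * enorm y]. *)
Lemma le_dot_enorm x y : dot x y <= enorm x * enorm y.
Proof.
have [->|/enorm_gt0 y0] := eqVneq y 0.
  by rewrite dot0r mulr_ge0 ?enorm_ge0.
have := dotxx_ge0 (enorm y *: x - (enorm x) *: y).
rewrite !(dotBl, dotBr, dotZl, dotZr) -!sqr_enorm (dotC y x) => h.
have [->|/enorm_gt0 x0] := eqVneq x 0.
  by rewrite dot0l mulr_ge0 ?enorm_ge0.
have xy0 : 0 < enorm x * enorm y by rewrite mulr_gt0.
rewrite -(ler_pM2l xy0); nra.
Qed.

Lemma ler_dot_enorm x y : `|dot x y| <= enorm x * enorm y.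
Proof.
rewrite ler_norml le_dot_enorm andbT lerNl -dotNl.
by rewrite (le_trans (le_dot_enorm _ _))// enormN.
Qed.

Lemma ler_enormD x y : enorm (x + y) <= enorm x + enorm y.
Proof.
rewrite -(@ler_pXn2r _ 2)// ?nnegrE ?addr_ge0 ?enorm_ge0//.
rewrite sqr_enorm dotDl !dotDr -!sqr_enorm (dotC y x).
have := le_dot_enorm x y; nra.
Qed.

Lemma ler_coord_enorm x i : `|x 0 i| <= enorm x.
Proof.
rewrite -dot_deltal (le_trans (ler_dot_enorm _ _))//.
suff -> : enorm ('e_i : 'rV[R]_d) = 1 by rewrite mul1r.
by rewrite /enorm dot_deltal mxE !eqxx sqrtr1.
Qed.

Lemma ler_norm_enorm x : `|x| <= enorm x.
Proof.
rewrite [leLHS]/Num.Def.normr /= mx_normrE; apply: bigmax_le => [|[i j] _ /=].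
  exact: enorm_ge0.
by rewrite ord1 ler_coord_enorm.
Qed.

Lemma ler_coord_norm x i : `|x 0 i| <= `|x|.
Proof.
rewrite [leRHS]/Num.Def.normr /= mx_normrE.
exact: (le_bigmax _ (fun j : 'I_1 * 'I_d => `|x j.1 j.2|) (0, i)).
Qed.

Lemma ler_enorm_norm x : enorm x <= d%:R * `|x|.
Proof.
have d0 : 0 <= d%:R * `|x| by rewrite mulr_ge0.
rewrite -(@ler_pXn2r _ 2)// ?nnegrE ?enorm_ge0// sqr_enorm.
apply: (@le_trans _ _ (\sum_(i < d) `|x| ^+ 2)).
  apply: ler_sum => i _; rewrite -expr2 -[leLHS]real_normK ?num_real//.
  by rewrite ler_pXn2r// ?nnegrE//; exact: ler_coord_norm.
rewrite sumr_const card_ord exprMn -[leLHS]mulr_natl ler_wpM2r ?sqr_ge0//.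
by rewrite -natrX ler_nat; case: (d) => // n; rewrite leq_pmulr.
Qed.

Lemma continuous_dotl y : continuous (fun x : 'rV[R]_d => dot x y).
Proof.
move=> x; apply: continuous_at_sum => i; apply: continuous_atM.
  exact: coord_continuous.
exact: cst_continuous.
Qed.

Lemma continuous_dotxx : continuous (fun x : 'rV[R]_d => dot x x).
Proof.
by move=> x; apply: continuous_at_sum => i; apply: continuous_atM; exact: coord_continuous.
Qed.

Lemma continuous_enorm : continuous (@enorm R d).
Proof.
move=> x; apply: (@continuous_comp _ _ _ (fun x => dot x x) Num.sqrt).
  exact: continuous_dotxx.
exact: sqrt_continuous.
Qed.

End EuclideanFacts.

(** * Calculus on curves *)

Section Calculus.
Variable R : realType.

Lemma is_derive_line (V W : normedModType R) (f : V -> W) x v (s : R) l :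
  is_derive (x + s *: v) v f l -> is_derive s 1 (fun s => f (x + s *: v)) l.
Proof.
have E : (fun h : R => h^-1 *: (f (x + (h *: 1 + s) *: v) - f (x + s *: v))) =
         (fun h : R => h^-1 *: (f (h *: v + (x + s *: v)) - f (x + s *: v))).
  apply/funext => h; congr (_ *: (f _ - _)).
  by rewrite scalerDl addrCA [h *: 1]mulr1.
move=> [df <-]; apply: DeriveDef; last by rewrite /derive /= E.
by rewrite /derivable /= E.
Qed.

Lemma MVT_closed (f df : R -> R) (a b : R) : a <= b ->
  (forall x : R, a <= x <= b -> is_derive x 1 f (df x)) ->
  exists2 c, a <= c <= b & f b - f a = df c * (b - a).
Proof.
move=> ab dfx; have [|| c cab e] := @MVT_segment R f df a b ab.
- by move=> x xab; apply: dfx; rewrite !(itvP xab).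
- apply: derivable_within_continuous => x; rewrite in_itv /= => xab.
  by have [] := dfx x xab.
- by exists c.
Qed.

Lemma MVT_origin (f df : R -> R) (s : R) :
  (forall x : R, `|x| <= `|s| -> is_derive x 1 f (df x)) ->
  exists2 c, `|c| <= `|s| & f s - f 0 = s * df c.
Proof.
move=> dfx; have [s0|s0] := leP 0 s.
  have [|c c0s e] := @MVT_closed f df 0 s s0.
    by move=> x /andP[x0 xs]; apply: dfx; rewrite !ger0_norm.
  move/andP: c0s => [c0 cs]; exists c; first by rewrite !ger0_norm.
  by rewrite e subr0 mulrC.
have [|c cs0 e] := @MVT_closed f df s 0 (ltW s0).
  by move=> x /andP[xs x0]; apply: dfx; rewrite !ler0_norm ?lerN2// ltW.
move/andP: cs0 => [cs c0]; exists c; first by rewrite !ler0_norm ?lerN2// ltW.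
by rewrite -opprB e sub0r mulrN opprK mulrC.
Qed.

(** By Fermat [dphi 0 = 0]. Were [l] positive, [dphi] would be positive just to the right of 0, and
    the mean value theorem would lift [phi] above [phi 0]. *)
Lemma second_derivative_at_max (phi dphi : R -> R) (l : R) :
  (forall t : R, is_derive t 1 phi (dphi t)) -> is_derive (0 : R) 1 dphi l ->
  (\forall t \near 0, phi t <= phi 0) -> l <= 0.
Proof.
move=> dp ddp [e /= e0 pmax].
have pm t : `|t| < e -> phi t <= phi 0.
  by move=> te; apply: pmax; rewrite /= sub0r normrN.
have dp0 : dphi 0 = 0.
  have := @derive1_at_max R phi (- e) e 0.
  rewrite !in_itv /= oppr_lt0 e0 => /(_ _ _ isT) h.
  have := h _ _ _; case.
  - by rewrite -subr_ge0 opprK addr_ge0// ltW.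
  - by move=> t _; have [] := dp t.
  - by move=> t; rewrite in_itv /= -ltr_norml; exact: pm.
  - by move=> _ d0; have [_ <-] := dp 0.
rewrite leNgt; apply/negP => l0.
have [ex] := ddp => dl.
have : (fun h : R => h^-1 *: (dphi (h *: 1 + 0) - dphi 0)) @ 0^' --> l by rewrite -dl.
move=> /cvgrPdist_lt/(_ l l0)[r /= r0 hr].
pose m := Num.min e r; have m0 : 0 < m by rewrite lt_min e0.
have dpos t : 0 < t < m -> 0 < dphi t.
  move=> /andP[t0]; rewrite lt_min => /andP[te tr].
  have := hr t; rewrite /= sub0r normrN gtr0_norm// => /(_ tr).
  rewrite gt_eqF// => /(_ isT).
  rewrite dp0 subr0 addr0 [t *: 1]mulr1 ltr_distl => /andP[_].
  by rewrite ltrDr [_ *: _]/(_ * _) pmulr_rgt0// invr_gt0.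
have m20 : 0 < m / 2 by rewrite divr_gt0.
have [|c cm e1] := @MVT R phi dphi 0 (m / 2) m20 (fun t _ => dp t).
  by apply: derivable_within_continuous => t _; have [] := dp t.
have := pm (m / 2); rewrite gtr0_norm// => /(_ _) h.
have : phi (m / 2) <= phi 0.
  apply: h; apply: lt_le_trans (_ : m <= e); last by rewrite ge_min lexx.
  by rewrite ltr_pdivrMr// ltr_pMr// ltr1n.
apply/negP; rewrite -ltNge -subr_gt0 e1 subr0 mulr_gt0// dpos//.
move: cm; rewrite in_itv /= => /andP[-> /lt_trans]; apply.
by rewrite ltr_pdivrMr// ltr_pMr// ltr1n.
Qed.

(** The increment of [Q] over a mesh interval is its length times [dQ] at some point within one mesh
    of the left node; moving to the node costs at most [e] per unit length. *)
Lemma riemann_sum_derivative (Q dQ : R -> R) (a b e : R) (N : nat) : a <= b ->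
  (forall r : R, a <= r <= b -> is_derive r 1 Q (dQ r)) ->
  (forall r s, a <= r <= b -> a <= s <= b -> `|r - s| <= (b - a) / N.+1%:R ->
    `|dQ r - dQ s| <= e) ->
  let h := (b - a) / N.+1%:R in
  `| h * \sum_(j < N.+1) dQ (a + j%:R * h) - (Q b - Q a) | <= (b - a) * e.
Proof.
move=> ab dQr dQe; set h := (b - a) / N.+1%:R; rewrite /=.
have h0 : 0 <= h by rewrite divr_ge0 ?subr_ge0.
have Nh : N.+1%:R * h = b - a by rewrite /h mulrC divfK.
have node j : (j <= N.+1)%N -> a <= a + j%:R * h <= b.
  move=> jN; rewrite lerDl mulr_ge0//= -lerBrDl -Nh ler_wpM2r// ler_nat//.
have -> : Q b - Q a = \sum_(j < N.+1) (Q (a + j.+1%:R * h) - Q (a + j%:R * h)).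
  rewrite -(big_mkord xpredT (fun j => Q (a + j.+1%:R * h) - Q (a + j%:R * h))).
  by rewrite telescope_sumr// mul0r addr0 Nh [a + _]addrC subrK.
rewrite mulr_sumr -sumrB (le_trans (ler_norm_sum _ _ _))//.
rewrite -Nh -[_ * h * e]mulrA [leRHS]mulr_natl.
rewrite -[in leRHS](card_ord N.+1) -sumr_const ler_sum// => j _.
have step : a + j%:R * h <= a + j.+1%:R * h.
  by rewrite lerD2l ler_wpM2r// ler_nat.
have [|c cj ->] := @MVT_closed Q dQ _ _ step.
  move=> r /andP[r1 r2]; apply: dQr.
  have /andP[n1 _] := node j (ltnW (ltn_ord j)).
  have /andP[_ n2] := node j.+1 (ltn_ord j).
  by rewrite (le_trans n1)//= (le_trans r2).
have Eh : a + j.+1%:R * h - (a + j%:R * h) = h by rewrite -natr1; ring.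
rewrite Eh mulrC -mulrBl normrM (ger0_norm h0) mulrC ler_wpM2l//.
have [n1 n2] := (node j (ltnW (ltn_ord j)), node j.+1 (ltn_ord j)).
apply: dQe => //.
  case/andP: n1 => n1 _; case/andP: n2 => _ n2; case/andP: cj => c1 c2.
  by rewrite (le_trans n1)//= (le_trans c2).
rewrite distrC ger0_norm ?subr_ge0; last by case/andP: cj.
by rewrite -/h -{2}Eh lerB//; case/andP: cj.
Qed.

End Calculus.

(** * Differentiability of functions of class C^1 and the chain rule along curves *)

Lemma diff_near_linear (R : realType) (V W : normedModType R) (f : V -> W)
    (df : {linear V -> W}) (x : V) : continuous df ->
  (forall e : R, 0 < e ->
    \forall h \near (0 : V), `|f (h + x) - f x - df h| <= e * `|h|) ->
  differentiable f x /\ 'd f x = df :> (V -> W).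
Proof.
move=> cdf fdf.
have fE : f \o shift x = cst (f x) + df +o_ 0 id.
  apply/eqaddoP => _/posnumP[e]; near=> h.
  rewrite !fctE /= opprD addrA; near: h; exact: fdf.
have dfE : 'd f x = df :> (V -> W) by exact: diff_unique.
by split=> //; apply/diff_locallyP; split; rewrite dfE.
Unshelve. all: by end_near. Qed.

Section ChainRule.
Variables (R : realType) (d : nat).
Implicit Types (h : 'rV[R]_d) (f : 'rV[R]_d -> R) (V : set 'rV[R]_d).

Lemma partial_MVT f (y : 'rV[R]_d) (i : 'I_d) (s : R) :
  (forall z, `|z| <= `|s| -> derivable f (y + z *: 'e_i) 'e_i) ->
  exists2 z, `|z| <= `|s| & f (y + s *: 'e_i) - f y = s * partial i f (y + z *: 'e_i).
Proof.
move=> fd; have [|z zs e] := @MVT_origin R (fun z => f (y + z *: 'e_i))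
  (fun z => partial i f (y + z *: 'e_i)) s.
  by move=> z zs; apply: is_derive_line; apply: derivableP; exact: fd.
by exists z => //; rewrite -e scale0r addr0.
Qed.

(** The points [x + head_row k h] lead from [x] to [x + h], one coordinate direction at a time. *)
Definition head_row (k : nat) (h : 'rV[R]_d) : 'rV[R]_d :=
  \row_j (if (j < k)%N then h 0 j else 0).

Lemma head_rowS (k : 'I_d) h : head_row k.+1 h = head_row k h + h 0 k *: 'e_k.
Proof.
apply/rowP => j; rewrite !mxE /= ltnS leq_eqVlt.
have [->|jk] := eqVneq j k; first by rewrite eqxx ltnn !mulr1 add0r.
by rewrite mulr0 addr0 -[(j == k :> nat)]/(j == k) (negbTE jk).
Qed.

Lemma norm_head_row (k : 'I_d) h z : `|z| <= `|h 0 k| ->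
  `|head_row k h + z *: 'e_k| <= `|h|.
Proof.
move=> zh; rewrite [leLHS]/Num.Def.normr /= mx_normrE.
apply: bigmax_le => [//|[i j] _ /=]; rewrite ord1 !mxE /=.
have [->|jk] := eqVneq j k.
  by rewrite ltnn add0r mulr1 (le_trans zh)// ler_coord_norm.
by rewrite mulr0 addr0; case: ifP => _; rewrite ?normr0 ?ler_coord_norm.
Qed.

(** Each step of the axis-parallel path is handled by the mean value theorem in one variable. The
    path stays within sup-norm distance [|h|] of [x], where the partial derivatives are close to
    their values at [x]. *)
Lemma class_C1_near_linear V f x : open V -> class_C 1 V f -> V x ->
  forall e : R, 0 < e -> \forall h \near (0 : 'rV[R]_d),
    `|f (h + x) - f x - \sum_i h 0 i * partial i f x| <= e * `|h|.
Proof.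
move=> oV [_ fC] Vx e e0.
(* The tolerance is shared by the [d] coordinates; the successor avoids a division by zero for
   [d = 0]. *)
have e1 : 0 < e / d.+1%:R by rewrite divr_gt0.
have : \forall y \near x, V y /\ forall i, `|partial i f x - partial i f y| < e / d.+1%:R.
  apply: filterI; first exact: open_nbhs_nbhs.
  apply: (@filter_forall _ _ _ (nbhs x) (nbhs_filter x)) => i; have [_ [ci _]] := fC i.
  by have /cvgrPdist_lt := ci x (mem_set Vx); exact.
move=> /nbhs_ballP[r /= r0 xr].
apply/nbhs_ballP; exists r => // h; rewrite -ball_normE /= sub0r normrN => hr.
have near k z : `|z| <= `|h 0 k| -> let y := x + (head_row k h + z *: 'e_k) in
    V y /\ forall i, `|partial i f x - partial i f y| < e / d.+1%:R.
  move=> zh y; apply: xr; rewrite -ball_normE /= /y opprD addNKr normrN.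
  exact: le_lt_trans (norm_head_row zh) hr.
have -> : f (h + x) - f x = \sum_(k < d) (f (x + head_row k.+1 h) - f (x + head_row k h)).
  rewrite -(big_mkord xpredT (fun k => f (x + head_row k.+1 h) - f (x + head_row k h))).
  rewrite telescope_sumr//; congr (f _ - f _).
    by rewrite addrC; congr (_ + _); apply/rowP => j; rewrite mxE ltn_ord.
  by rewrite [head_row 0 h](_ : _ = 0) ?addr0//; apply/rowP => j; rewrite !mxE.
rewrite -sumrB (le_trans (ler_norm_sum _ _ _))//.
apply: (@le_trans _ _ (\sum_(k < d) (e / d.+1%:R * `|h|))); last first.
  rewrite sumr_const card_ord -[leLHS]mulr_natl mulrA ler_wpM2r// mulrCA.
  by rewrite ler_piMr ?(ltW e0)// ler_pdivrMr// mul1r ler_nat.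
apply: ler_sum => k _; rewrite head_rowS addrA.
have [|z zh ->] := @partial_MVT f (x + head_row k h) k (h 0 k).
  move=> z /near[]; rewrite addrA => Vy _.
  by have [+ _] := fC k; apply.
rewrite -mulrBr normrM mulrC ler_pM ?ler_coord_norm//.
by have [_ /(_ k)/ltW] := near k z zh; rewrite addrA distrC.
Qed.

Definition gradient_form (f : 'rV[R]_d -> R) (x h : 'rV[R]_d) : R :=
  \sum_i h 0 i * partial i f x.

Lemma gradient_form_linear f x : linear (gradient_form f x).
Proof.
move=> c u v; rewrite /gradient_form scaler_sumr -big_split /=.
by apply: eq_bigr => i _; rewrite !mxE mulrDl -mulrA.
Qed.

Lemma continuous_gradient_form f x : continuous (gradient_form f x).
Proof.
move=> h; apply: continuous_at_sum => i; apply: continuous_atM.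
  exact: coord_continuous.
exact: cst_continuous.
Qed.

Lemma class_C1_diff V f x : open V -> class_C 1 V f -> V x ->
  differentiable f x /\ 'd f x = gradient_form f x :> ('rV[R]_d -> R).
Proof.
move=> oV fC Vx.
pose L := GRing.isLinear.Build _ _ _ _ _ (gradient_form_linear f x).
pose G : {linear 'rV[R]_d -> R} := HB.pack (gradient_form f x) L.
apply: (@diff_near_linear _ _ _ f G x); first exact: continuous_gradient_form.
by move=> e e0; exact: class_C1_near_linear oV fC Vx e e0.
Qed.

Lemma is_derive_curve V f (g dg : R -> 'rV[R]_d) (t : R) :
  open V -> class_C 1 V f -> V (g t) ->
  (forall i, is_derive t 1 (fun s => g s 0 i) (dg t 0 i)) ->
  is_derive t 1 (fun s => f (g s)) (\sum_i dg t 0 i * partial i f (g t)).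
Proof.
move=> oV fC Vg gd.
have dg1 : derivable g t 1.
  by apply/derivable_mxP => i j; rewrite ord1; have [] := gd j.
have /derivable1_diffP dg2 := dg1.
have [df dE] := class_C1_diff oV fC Vg.
have dfg : differentiable (f \o g) t by exact: differentiable_comp.
apply: DeriveDef; first by apply/derivable1_diffP.
rewrite -[LHS]/('D_1 (f \o g) t) deriveE// diff_comp//= dE -deriveE//.
apply: eq_bigr => i _; rewrite derive_mx// mxE; congr (_ * _).
by have [_ ->] := gd i.
Qed.

End ChainRule.

(** * The spherical Laplacian *)

Section Rotations.
Variables (R : realType) (d : nat).
Implicit Types (theta x n p q : 'rV[R]_d) (i j k l : 'I_d).

Definition rot_velocity theta i j : 'rV[R]_d := theta 0 i *: 'e_j - theta 0 j *: 'e_i.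

(** The component of [theta] in the coordinate plane of [i] and [j]. The factor makes it vanish for
    [i = j], so that [rot] is then constant. *)
Definition rot_plane theta i j : 'rV[R]_d :=
  (i != j)%:R *: (theta 0 i *: 'e_i + theta 0 j *: 'e_j).

Definition rot theta i j (t : R) : 'rV[R]_d :=
  theta + sin t *: rot_velocity theta i j + (cos t - 1) *: rot_plane theta i j.

Definition rot' theta i j (t : R) : 'rV[R]_d :=
  cos t *: rot_velocity theta i j - sin t *: rot_plane theta i j.

Lemma rot0 theta i j : rot theta i j 0 = theta.
Proof. by rewrite /rot sin0 cos0 subrr !scale0r !addr0. Qed.

Lemma rot'0 theta i j : rot' theta i j 0 = rot_velocity theta i j.
Proof. by rewrite /rot' sin0 cos0 scale1r scale0r subr0. Qed.

Lemma dot_rot_velocity theta i j p :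
  dot (rot_velocity theta i j) p = theta 0 i * p 0 j - theta 0 j * p 0 i.
Proof. by rewrite dotBl !dotZl !dot_deltal. Qed.

Lemma dot_rot_plane theta i j p :
  dot (rot_plane theta i j) p =
  (i != j)%:R * (theta 0 i * p 0 i + theta 0 j * p 0 j).
Proof. by rewrite dotZl dotDl !dotZl !dot_deltal. Qed.

Lemma dot_rot theta i j t p :
  dot (rot theta i j t) p = dot theta p + sin t * dot (rot_velocity theta i j) p +
    (cos t - 1) * dot (rot_plane theta i j) p.
Proof.
by rewrite (dotDl (theta + _)) (dotDl theta) (dotZl (sin t)) (dotZl (cos t - 1)).
Qed.

Lemma dot_rot' theta i j t p :
  dot (rot' theta i j t) p =
  cos t * dot (rot_velocity theta i j) p - sin t * dot (rot_plane theta i j) p.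
Proof. by rewrite (dotBl (cos t *: _)) (dotZl (cos t)) (dotZl (sin t)). Qed.

Lemma sphere_rot theta i j t : sphere theta -> sphere (rot theta i j t).
Proof.
move=> th1; suff E : dot (rot theta i j t) (rot theta i j t) = 1.
  by rewrite /sphere /= /enorm E sqrtr1.
have [->|ij] := eqVneq i j.
  have -> : rot theta j j t = theta by
    rewrite /rot /rot_velocity /rot_plane subrr eqxx !(scale0r, scaler0) !addr0.
  exact: dot_sphere.
have cs := cos2Dsin2 t.
rewrite dot_rot (dotC _ (rot _ _ _ _)) dot_rot (dotC _ (rot _ _ _ _)) dot_rot.
rewrite [dot (rot_plane _ _ _) (rot _ _ _ _)]dotC dot_rot.
rewrite (dotC theta (rot_velocity _ _ _)) (dotC theta (rot_plane _ _ _)).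
rewrite !dot_rot_velocity !dot_rot_plane ij (dot_sphere th1).
rewrite /rot_velocity /rot_plane ij !mxE /= !eqxx (negbTE ij) eq_sym (negbTE ij).
move: cs; set c := cos t; set s := sin t => cs.
rewrite [LHS](_ : _ = 1 + (theta 0 i ^+ 2 + theta 0 j ^+ 2) * (c ^+ 2 + s ^+ 2 - 1)).
  by rewrite cs subrr mulr0 addr0.
rewrite /=; ring.
Qed.

Lemma is_derive_dot_rot theta i j (t : R) p :
  is_derive t 1 (fun s => dot (rot theta i j s) p) (dot (rot' theta i j t) p).
Proof.
have -> : (fun s => dot (rot theta i j s) p) =
    (fun s => dot theta p + sin s * dot (rot_velocity theta i j) p +
    (cos s - 1) * dot (rot_plane theta i j) p).
  by apply/funext => s; rewrite dot_rot.
apply: is_derive_eq; rewrite dot_rot'.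
by rewrite /GRing.scale /=; ring.
Qed.

Lemma is_derive_dot_rot' theta i j p :
  is_derive (0 : R) 1 (fun s => dot (rot' theta i j s) p)
    (- dot (rot_plane theta i j) p).
Proof.
have -> : (fun s => dot (rot' theta i j s) p) =
    (fun s => cos s * dot (rot_velocity theta i j) p -
      sin s * dot (rot_plane theta i j) p).
  by apply/funext => s; rewrite dot_rot'.
apply: is_derive_eq; rewrite sin0 cos0.
by rewrite /GRing.scale /=; ring.
Qed.

(** The right side is twice the bilinear form of the projection onto the tangent space at [theta]:
    each coordinate plane is counted in both orders. *)
Lemma sum_rot_velocity theta p q : sphere theta ->
  \sum_i \sum_j dot (rot_velocity theta i j) p * dot (rot_velocity theta i j) q =
  2 * (dot p q - dot theta p * dot theta q).
Proof.
move=> /dot_sphere th1.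
have mulsum (a b : 'I_d -> R) :
    \sum_i \sum_j a i * b j = (\sum_i a i) * (\sum_j b j).
  by rewrite mulr_suml; apply: eq_bigr => i _; rewrite mulr_sumr.
transitivity (\sum_i \sum_j (theta 0 i * theta 0 i) * (p 0 j * q 0 j) +
    \sum_i \sum_j (p 0 i * q 0 i) * (theta 0 j * theta 0 j) -
    \sum_i \sum_j (theta 0 i * p 0 i) * (theta 0 j * q 0 j) -
    \sum_i \sum_j (theta 0 i * q 0 i) * (theta 0 j * p 0 j)).
  rewrite -big_split -!sumrB; apply: eq_bigr => i _ /=.
  rewrite -big_split -!sumrB; apply: eq_bigr => j _ /=.
  by rewrite !dot_rot_velocity; ring.
rewrite !mulsum -!/(dot _ _) th1; ring.
Qed.

(** Each coordinate belongs to [d - 1] coordinate planes, each counted in both orders. *)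
Lemma sum_rot_plane theta p :
  \sum_i \sum_j dot (rot_plane theta i j) p = 2 * (d%:R - 1) * dot theta p.
Proof.
have row (a : 'I_d -> R) i : \sum_j (i != j)%:R * a j = \sum_j a j - a i.
  rewrite (bigD1 i)//= [in RHS](bigD1 i)//= eqxx mul0r add0r addrAC subrr add0r.
  by apply: eq_bigr => j ji; rewrite eq_sym ji mul1r.
under eq_bigr do under eq_bigr do rewrite dot_rot_plane.
under eq_bigr do rewrite row big_split /= sumr_const card_ord -mulr_natl.
rewrite sumrB !big_split /= sumr_const card_ord -mulr_sumr -/(dot theta p) -mulr_natl.
by ring.
Qed.

End Rotations.

(** * Reflections in hyperplanes through the origin *)

Section Reflection.
Variables (R : realType) (d : nat).
Implicit Types (n x y : 'rV[R]_d).

(** The condition [dot n n *: n = n] used below says that [n] is a unit vector or zero. The zero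
    vector gives the identity, so one statement covers a function and its mirror image. *)
Definition reflection n x : 'rV[R]_d := x - (2 * dot x n) *: n.

Lemma dot_reflectionC n x y : dot (reflection n x) y = dot x (reflection n y).
Proof.
by rewrite dotBl dotBr (dotZl (2 * _)) (dotZr (2 * _)) (dotC n y); ring.
Qed.

Lemma reflectionK n x : dot n n *: n = n -> reflection n (reflection n x) = x.
Proof.
move=> nn; rewrite {1}/reflection dotBl dotZl /reflection -addrA -opprD -scalerDl.
rewrite [X in X *: n](_ : _ = 4 * dot x n - 4 * dot x n * dot n n); last by ring.
by rewrite scalerBl -(scalerA _ (dot n n)) nn subrr subr0.
Qed.

Lemma dot_reflection n x y : dot n n *: n = n ->
  dot (reflection n x) (reflection n y) = dot x y.
Proof. by move=> nn; rewrite dot_reflectionC reflectionK. Qed.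

Lemma sphere_reflection n x : dot n n *: n = n -> sphere x -> sphere (reflection n x).
Proof. by move=> nn x1; rewrite /sphere /= /enorm dot_reflection. Qed.

Lemma reflection0 x : reflection 0 x = x.
Proof. by rewrite /reflection scaler0 subr0. Qed.

Lemma reflection_fixed n x : dot x n = 0 -> reflection n x = x.
Proof. by rewrite /reflection => ->; rewrite mulr0 scale0r subr0. Qed.

End Reflection.

Section SphericalLaplacian.
Variables (R : realType) (d : nat).
Implicit Types (F G : 'rV[R]_d -> R) (theta n x : 'rV[R]_d) (a l m : R).

(* The Laplace-Beltrami operator is the sum of the squares of the generators
   of the rotations in the coordinate planes; each plane is counted twice. *)
Definition has_spherical_laplacian F theta l : Prop :=
  exists F1 F2 : 'I_d -> 'I_d -> R -> R,
    [/\ forall i j (t : R), is_derive t 1 (fun s => F (rot theta i j s)) (F1 i j t),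
        forall i j, is_derive (0 : R) 1 (F1 i j) (F2 i j 0) &
        l = 2^-1 * \sum_i \sum_j F2 i j 0].

Lemma spherical_laplacianD F G theta l m :
  has_spherical_laplacian F theta l -> has_spherical_laplacian G theta m ->
  has_spherical_laplacian (fun x => F x + G x) theta (l + m).
Proof.
move=> [F1 [F2 [dF ddF ->]]] [G1 [G2 [dG ddG ->]]].
exists (fun i j t => F1 i j t + G1 i j t), (fun i j t => F2 i j t + G2 i j t).
split=> [i j t|i j|].
- have := dF i j t; have := dG i j t => ? ?; exact: is_deriveD.
- have := ddF i j; have := ddG i j => ? ?; exact: is_deriveD.
- by rewrite -mulrDr -big_split; congr (_ * _); apply: eq_bigr => i _; rewrite -big_split.
Qed.

Lemma spherical_laplacianZ F theta a l :
  has_spherical_laplacian F theta l ->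
  has_spherical_laplacian (fun x => a * F x) theta (a * l).
Proof.
move=> [F1 [F2 [dF ddF ->]]].
exists (fun i j t => a * F1 i j t), (fun i j t => a * F2 i j t).
split=> [i j t|i j|].
- have := dF i j t => ?; exact: is_deriveZ.
- have := ddF i j => ?; exact: is_deriveZ.
- rewrite mulrCA mulr_sumr; congr (_ * _); apply: eq_bigr => i _.
  by rewrite mulr_sumr.
Qed.

Lemma spherical_laplacian_sum (N : nat) (F : 'I_N -> 'rV[R]_d -> R) theta (l : 'I_N -> R) :
  (forall i, has_spherical_laplacian (F i) theta (l i)) ->
  has_spherical_laplacian (fun x => \sum_i F i x) theta (\sum_i l i).
Proof.
elim: N F l => [|N IH] F l Fl.
  exists (fun _ _ _ => 0), (fun _ _ _ => 0); split=> [i j t|i j|].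
  - by under [X in is_derive _ _ X _]eq_fun do rewrite big_ord0; exact: is_derive_cst.
  - exact: is_derive_cst.
  - by rewrite big_ord0 big1 ?mulr0// => i _; rewrite big1.
under eq_fun do rewrite big_ord_recl; rewrite big_ord_recl.
by apply: spherical_laplacianD => //; apply: IH => i; exact: Fl.
Qed.

(** Along each rotation curve the restriction of [F] has a local maximum at parameter 0, so every
    summand is nonpositive. *)
Lemma spherical_laplacian_at_max F theta l :
  has_spherical_laplacian F theta l ->
  (forall i j, \forall t \near (0 : R), F (rot theta i j t) <= F theta) -> l <= 0.
Proof.
move=> [F1 [F2 [dF ddF ->]]] Fmax.
rewrite pmulr_rle0 ?invr_gt0// sumr_le0// => i _; rewrite sumr_le0// => j _.
apply: (second_derivative_at_max (dF i j) (ddF i j)).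
by rewrite rot0; exact: Fmax.
Qed.

(** On a function phi of [s] the spherical Laplacian is (1 - s^2) phi'' - (d - 1) s phi', here with
    phi = 2 s - s^2 / 2. For [d >= 2], [0 <= s <= 1] and [m >= 0] the value is at most [- m]. *)
Lemma spherical_laplacian_barrier m n theta : sphere n -> sphere theta ->
  let s := dot theta n in
  has_spherical_laplacian (fun x => m * (2 * dot x n - (dot x n) ^+ 2 / 2)) theta
    (m * (- 2 * (d%:R - 1) * s - 1 + d%:R * s ^+ 2)).
Proof.
move=> /dot_sphere n1 th1 s.
exists (fun i j t => m * (2 - dot (rot theta i j t) n) * dot (rot' theta i j t) n).
exists (fun i j _ => m * (- (2 - s) * dot (rot_plane theta i j) n -
   dot (rot_velocity theta i j) n * dot (rot_velocity theta i j) n)).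
split=> [i j t|i j|].
- have := is_derive_dot_rot theta i j t n => ?.
  by apply: is_derive_eq; rewrite /GRing.scale /= !exprS !expr0; field.
- have := is_derive_dot_rot theta i j 0 n => ?.
  have := is_derive_dot_rot' theta i j n => ?.
  by apply: is_derive_eq; rewrite /GRing.scale /= rot0 rot'0 -/s; ring.
under eq_bigr do rewrite -mulr_sumr sumrB -mulr_sumr.
rewrite -mulr_sumr sumrB -mulr_sumr sum_rot_plane sum_rot_velocity// n1 -/s.
by field.
Qed.

End SphericalLaplacian.

(** * The Laplacian in polar coordinates *)

Section Helmholtz.
Variables (R : realType) (d : nat).
Implicit Types (f : 'rV[R]_d -> R) (V : set 'rV[R]_d) (theta n x h : 'rV[R]_d).

Definition hessian_form f x h : R := \sum_i h 0 i * gradient_form (partial i f) x h.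

Definition real_laplacian f x : R := \sum_i partial i (partial i f) x.

Lemma class_C2_partial V f i : class_C 2 V f -> class_C 1 V (partial i f).
Proof. by case=> _ /(_ i)[]. Qed.

Lemma class_CS m V f : class_C m.+1 V f -> class_C m V f.
Proof.
elim: m f => [|m IH] f [cf fC]; first by split.
by split=> // i; have [fd fi] := fC i; split=> //; exact: IH.
Qed.

(** The polar form of the Laplacian solved for its angular part. In the second derivative along a
    rotation curve, the velocities yield the tangential second derivatives and the acceleration,
    [- rot_plane], yields the first-order term; the two sums over planes evaluate both. *)
Lemma spherical_laplacian_sphere V f n theta (r : R) :
  open V -> class_C 2 V f -> dot n n *: n = n -> sphere theta ->
  (forall x, sphere x -> V (r *: x)) ->
  let w := reflection n theta in
  has_spherical_laplacian (fun x => f (r *: reflection n x)) theta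
    (r ^+ 2 * (real_laplacian f (r *: w) - hessian_form f (r *: w) w) -
     (d%:R - 1) * r * gradient_form f (r *: w) w).
Proof.
move=> oV fC nn th1 rV w.
(* The reflected frame is again orthonormal. Coordinates of the reflected curve are dot products of
   the original curve with it, so the sums over planes apply unchanged. *)
pose e (k : 'I_d) := reflection n 'e_k.
pose g i j s := r *: reflection n (rot theta i j s).
pose dg i j s := r *: reflection n (rot' theta i j s).
have entry c x k : (c *: reflection n x) 0 k = c * dot x (e k).
  by rewrite mxE -dot_deltar dot_reflectionC.
have Vg i j s : V (g i j s).
  by apply: rV; apply: sphere_reflection => //; exact: sphere_rot.
have gd i j (t : R) k : is_derive t 1 (fun s => g i j s 0 k) (dg i j t 0 k).
  under eq_fun do rewrite entry; rewrite entry.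
  have := is_derive_dot_rot theta i j t (e k) => ?; exact: is_deriveZ.
exists (fun i j t => \sum_k dg i j t 0 k * partial k f (g i j t)).
exists (fun i j t => \sum_k
  (- (r * dot (rot_plane theta i j) (e k)) * partial k f (r *: w) +
  \sum_l r ^+ 2 *
     (dot (rot_velocity theta i j) (e k) * dot (rot_velocity theta i j) (e l)) *
     partial l (partial k f) (r *: w))).
have g0 i j : g i j 0 = r *: w by rewrite /g rot0.
split=> [i j t|i j|].
- exact: is_derive_curve oV (class_CS fC) (Vg i j t) (gd i j t).
- under eq_fun do under eq_bigr do rewrite entry.
  have E : (fun s => \sum_k (r * dot (rot' theta i j s) (e k)) * partial k f (g i j s)) =
     \sum_k (fun s => (r * dot (rot' theta i j s) (e k)) * partial k f (g i j s)).
    by apply/funext => s; rewrite fct_sumE.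
  rewrite E; apply: is_derive_sum => k.
  have d1 := is_derive_dot_rot' theta i j (e k).
  have d2 := is_derive_curve oV (class_C2_partial k fC) (Vg i j 0) (gd i j 0).
  apply: is_derive_eq; rewrite /GRing.scale /= g0 rot'0 addrC; congr (_ + _).
    by ring.
  rewrite mulr_sumr; apply: eq_bigr => l _.
  by rewrite entry rot'0; ring.
have esum k l : dot (e k) (e l) = (k == l)%:R.
  by rewrite dot_reflection// dot_deltal mxE eqxx.
have we k : dot theta (e k) = w 0 k by rewrite -dot_reflectionC dot_deltar.
under eq_bigr do rewrite exchange_big /=.
rewrite exchange_big /=.
under eq_bigr => k _.
  under eq_bigr do rewrite big_split /=.
  rewrite big_split /=.
  under eq_bigr do rewrite -mulr_suml sumrN -mulr_sumr.
  rewrite -mulr_suml sumrN -mulr_sumr sum_rot_plane we.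
  under [X in _ + X]eq_bigr do rewrite exchange_big /=.
  rewrite exchange_big /=.
  under [X in _ + X]eq_bigr => l _.
    under eq_bigr do rewrite -mulr_suml -mulr_sumr.
    rewrite -mulr_suml -mulr_sumr sum_rot_velocity// esum !we.
    over.
  over.
(* The Kronecker delta turns the trace into a double sum, comparable term by term with the left
   side. *)
have -> : real_laplacian f (r *: w) =
    \sum_k \sum_l (k == l)%:R * partial l (partial k f) (r *: w).
  apply: eq_bigr => k _; rewrite (bigD1 k)//= eqxx mul1r big1 ?addr0// => l lk.
  by rewrite eq_sym (negbTE lk) mul0r.
rewrite /hessian_form /gradient_form -sumrB !mulr_sumr -sumrB.
apply: eq_bigr => k _.
rewrite [in LHS]mulr_sumr -sumrB [in LHS]mulr_sumr [in RHS]mulrDr [RHS]addrC.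
rewrite [in RHS]mulr_sumr.
congr (_ + _); last by field.
by apply: eq_bigr => l _; field.
Qed.

Lemma is_derive_ray V f theta (r : R) : open V -> class_C 1 V f -> V (r *: theta) ->
  is_derive r 1 (fun s => f (s *: theta)) (gradient_form f (r *: theta) theta).
Proof.
move=> oV fC Vr; apply: (@is_derive_curve _ _ V f (fun s => s *: theta) (fun=> theta)) => //.
move=> i; under eq_fun do rewrite mxE.
by apply: is_derive_eq; rewrite /GRing.scale /= mulr1 mulr0 add0r.
Qed.

Lemma is_derive_ray2 V f theta (r : R) : open V -> class_C 2 V f -> V (r *: theta) ->
  is_derive r 1 (fun s => gradient_form f (s *: theta) theta)
    (hessian_form f (r *: theta) theta).
Proof.
move=> oV fC Vr.
have -> : (fun s => gradient_form f (s *: theta) theta) =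
    \sum_i (fun s => theta 0 i * partial i f (s *: theta)).
  by apply/funext => s; rewrite fct_sumE.
apply: is_derive_sum => i.
have := is_derive_ray oV (class_C2_partial i fC) Vr => ?; exact: is_deriveZ.
Qed.

End Helmholtz.

(** * Maximum principle on a half sphere *)

Section MaximumPrinciple.
Variables (R : realType) (d : nat).
Implicit Types (F G : 'rV[R]_d -> R) (theta n x : 'rV[R]_d).

Lemma compact_half_sphere n :
  compact [set x : 'rV[R]_d | sphere x /\ 0 <= dot x n].
Proof.
apply: bounded_closed_compact.
  exists 1; split; first exact: num_real.
  by move=> M M1 x /= [x1 _]; rewrite (le_trans (ler_norm_enorm x))// [enorm x]x1 ltW.
have -> : [set x : 'rV[R]_d | sphere x /\ 0 <= dot x n] =
    (@enorm R d @^-1` [set 1]) `&` ((fun x => dot x n) @^-1` [set y | 0 <= y]) by [].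
apply: closedI; apply: closed_comp.
- by move=> x _; exact: continuous_enorm.
- exact: closed_eq.
- by move=> x _; exact: continuous_dotl.
- exact: closed_ge.
Qed.

(** [F] attains its maximum on the closed half sphere. A positive Laplacian excludes the open half,
    so the maximum is on the mirror, where [F <= 0]. *)
Lemma half_sphere_maximum n F :
  (forall x, sphere x -> {for x, continuous F}) ->
  (forall x, sphere x -> 0 < dot x n ->
    exists2 l, has_spherical_laplacian F x l & 0 < l) ->
  (forall x, sphere x -> dot x n = 0 -> F x <= 0) ->
  forall x, sphere x -> 0 <= dot x n -> F x <= 0.
Proof.
move=> Fc Fl F0 x x1 xn.
have [|||c /set_mem[c1 cn] cmax] := @EVT_max_rV R d F [set x | sphere x /\ 0 <= dot x n].
- by exists x.
- exact: compact_half_sphere.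
- by apply: continuous_in_subspaceT => y /set_mem[y1 _]; exact: Fc.
have max y : sphere y -> 0 <= dot y n -> F y <= F c.
  by move=> y1 yn; apply: cmax; rewrite inE.
apply: (le_trans (max _ x1 xn)).
move: cn; rewrite le_eqVlt => /predU1P[cn|cn]; first exact: F0.
have [l Fcl l0] := Fl c c1 cn.
suff : l <= 0 by rewrite leNgt l0.
apply: (spherical_laplacian_at_max Fcl) => i j.
(* Short rotations of [c] stay in the half sphere, so [c] is a local maximum along each rotation
   curve. *)
have : (dot (rot c i j t) n) @[t --> (0 : R)] --> dot c n.
  rewrite -[in X in _ --> X](rot0 c i j).
  have [+ _] := is_derive_dot_rot c i j 0 n.
  by move=> /derivable1_diffP/differentiable_continuous.
move=> /cvgrPdist_lt/(_ _ cn); apply: filterS => t.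
rewrite ltr_distlC => /andP[+ _]; rewrite subrr => /ltW tn.
by apply: max => //; exact: sphere_rot.
Qed.

(* Reflect x to y; F minus its reflection vanishes on the mirror and is compared
   with the barrier 3 M (2 s - s^2 / 2), s the distance to the mirror. *)
Lemma spherical_lipschitz F (M : R) : (2 <= d)%N -> 0 < M ->
  (forall x, sphere x -> {for x, continuous F}) ->
  (forall n x, dot n n *: n = n -> sphere x ->
    exists2 l, has_spherical_laplacian (fun y => F (reflection n y)) x l & `|l| <= M) ->
  forall x y, sphere x -> sphere y -> F x - F y <= 3 * M * enorm (x - y).
Proof.
move=> d2 M0 Fc Fl x y x1 y1.
have [->|xy] := eqVneq x y; first by rewrite !subrr /enorm dot0l sqrtr0 mulr0.
have xy0 : x - y != 0 by rewrite subr_eq0.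
have e0 := enorm_gt0 xy0.
pose n := direction (x - y).
have n1 : sphere n by exact: enorm_direction.
have nn : dot n n *: n = n by rewrite (dot_sphere n1) scale1r.
have exy : enorm (x - y) ^+ 2 = 2 - 2 * dot x y.
  rewrite sqr_enorm dotBl !dotBr (dot_sphere x1) (dot_sphere y1) (dotC y x); ring.
have xn : dot x n = enorm (x - y) / 2.
  rewrite /n dotZr dotBr (dot_sphere x1).
  have -> : 1 - dot x y = enorm (x - y) ^+ 2 / 2 by rewrite exy; field.
  by field; rewrite gt_eqF.
have ry : reflection n x = y.
  rewrite /reflection xn mulrC divfK// /n /direction scalerA divff ?gt_eqF//.
  by rewrite scale1r opprB addrC subrK.
have refl_cont : continuous (reflection n).
  move=> z; apply: (@continuous_atB _ _ _ _ id) => //; apply: continuous_atZ.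
  by apply: continuous_atMl; exact: continuous_dotl.
pose b z := 3 * M * (2 * dot z n - (dot z n * dot z n) / 2).
have b_cont : continuous b.
  rewrite /b => z; have zn := @continuous_dotl R d n z; apply: continuous_atMl.
  apply: continuous_atB; first by apply: continuous_atMl; exact: zn.
  by apply: continuous_atM; [exact: continuous_atM|exact: cst_continuous].
suff : F x + -1 * F (reflection n x) + -1 * b x <= 0.
  (* The barrier is at most [6 * M * dot x n], and [dot x n] is half the distance from [x] to [y]:
     hence the constant [3 * M]. *)
  rewrite ry !mulN1r -/(_ - _) subr_le0 => /le_trans; apply.
  rewrite /b -subr_ge0.
  have -> : 3 * M * enorm (x - y) - 3 * M * (2 * dot x n - dot x n * dot x n / 2) =
    3 * M * (dot x n ^+ 2 / 2) by rewrite xn; field.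
  by apply: mulr_ge0; rewrite ?divr_ge0 ?sqr_ge0// mulr_ge0// ltW.
apply: (@half_sphere_maximum n
  (fun z => F z + -1 * F (reflection n z) + -1 * b z)) => //; last first.
- by rewrite xn divr_ge0 ?enorm_ge0.
- move=> z z1 zn; rewrite reflection_fixed// /b zn; lra.
- move=> z z1 zn.
  (* The zero normal gives the bound for [F] itself, and [n] gives it for the mirror image. *)
  have [|l1 Fl1 l1M] := Fl 0 z _ z1; first by rewrite scaler0.
  have [l2 Fl2 l2M] := Fl n z nn z1.
  have := spherical_laplacian_barrier (3 * M) n1 z1; under eq_fun do rewrite expr2.
  move=> bl.
  exists (l1 + -1 * l2 +
      -1 * (3 * M * (- 2 * (d%:R - 1) * dot z n - 1 + d%:R * dot z n ^+ 2))).
    apply: spherical_laplacianD; last exact: spherical_laplacianZ bl.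
    apply: spherical_laplacianD; last exact: spherical_laplacianZ.
    have E0 : F = fun v => F (reflection 0 v).
      by apply/funext => v; rewrite reflection0.
    by rewrite [F in has_spherical_laplacian F]E0.
  have zn1 : dot z n <= 1.
    by rewrite (le_trans (le_dot_enorm _ _))// [enorm z]z1 [enorm n]n1 mulr1.
  have d2R : (2 : R) <= d%:R by rewrite ler_nat.
  move: l1M l2M zn zn1 d2R; rewrite !ler_norml.
  move: (dot z n) (d%:R : R) => s D /andP[h1 h2] /andP[h3 h4] s0 s1 D2.
  have : 0 <= s * (D - 2) by rewrite mulr_ge0 ?subr_ge0// ltW.
  have : 0 <= D * s * (1 - s) by rewrite !mulr_ge0 ?subr_ge0// ?(le_trans _ D2) // ltW.
  move=> k1 k2.
  (* Subtracting the barrier adds at least [3 * M] to the Laplacian, while [l1 - l2] is at least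
     [- 2 * M]; the total is positive. *)
  have : 0 <= 3 * M * (2 * (D - 1) * s - D * s ^+ 2).
    rewrite mulr_ge0 ?mulr_ge0 ?(ltW M0)//.
    have -> : 2 * (D - 1) * s - D * s ^+ 2 = D * s * (1 - s) + s * (D - 2) by ring.
    exact: addr_ge0.
  lra.
- move=> z z1; apply: continuous_atD; last first.
    by apply: continuous_atMl; exact: b_cont.
  apply: continuous_atD; first exact: Fc.
  apply: continuous_atMl.
  apply: (@continuous_comp _ _ _ (reflection n) F); first exact: refl_cont.
  by apply: Fc; exact: sphere_reflection.
Qed.

End MaximumPrinciple.

(** * Radial averages *)

(** Heine-Cantor: half of a local radius serves a whole neighbourhood of a point, and the covering
    form of compactness yields one radius for all of [A]. *)
Lemma compact_unif_continuous (R : realType) (V : normedModType R)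
    (f : V -> R) (A : set V) :
  compact A -> (forall x, A x -> continuous_at x f) ->
  forall e : R, 0 < e -> exists2 r : R, 0 < r &
    forall x y, A x -> A y -> `|x - y| < r -> `|f x - f y| < e.
Proof.
move=> cA cf e e0.
pose P (r : R) x := forall y, `|x - y| < r -> `|f x - f y| < e.
have [|r /= r0 rP] := (compact_near_coveringP A).1 cA R (0 : R)^'+ P _.
  move=> x Ax; have e2 : 0 < e / 2 by rewrite divr_gt0.
  have := cf x Ax; move=> /cvgrPdist_lt/(_ _ e2)/nbhs_ballP[r /= r0 rf].
  have r2 : 0 < r / 2 by rewrite divr_gt0.
  exists (ball x (r / 2), [set s | s < r / 2]).
    by split; [exact: nbhsx_ballx|exact: nbhs_right_lt].
  move=> [x' s] /= [xx' sr] y x'y.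
  have fx' : `|f x - f x'| < e / 2.
    by apply: rf; apply: (le_ball _ xx'); rewrite ler_piMr ?(ltW r0)// invf_le1// ler1n.
  have fy : `|f x - f y| < e / 2.
    apply: rf; rewrite -ball_normE /= (splitr r) -(subrKA x').
    rewrite (le_lt_trans (ler_normD _ _))// ltrD//.
      by move: xx'; rewrite -ball_normE.
    exact: lt_trans sr.
  rewrite (splitr e) -(subrKA (f x)) (le_lt_trans (ler_normD _ _))// ltrD//.
  by rewrite distrC.
exists (r / 2); first by rewrite divr_gt0.
move=> x y Ax _ xy; apply: (rP (r / 2)) => //=; last by rewrite divr_gt0.
rewrite sub0r normrN gtr0_norm ?divr_gt0//.
by rewrite ltr_pdivrMr// ltr_pMr// ltr1n.
Qed.

Section RadialSums.
Variables (R : realType) (d : nat).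
Implicit Types (rho r s : R) (phi : R -> R) (theta x : 'rV[R]_d).

(** The left Riemann sum over [rho, 2 rho] with [N.+1] equal steps. *)
Definition rsum rho (N : nat) phi : R :=
  rho / N.+1%:R * \sum_(j < N.+1) phi (rho + j%:R * (rho / N.+1%:R)).

Lemma rsum_node rho (N : nat) (j : 'I_N.+1) : 0 <= rho ->
  rho <= rho + j%:R * (rho / N.+1%:R) <= 2 * rho.
Proof.
move=> rho0; rewrite lerDl mulr_ge0 ?divr_ge0//= mulrDl mul1r lerD2l.
by rewrite mulrA ler_pdivrMr// mulrC ler_wpM2l// ler_nat ltnW.
Qed.

Lemma rsumD rho N phi1 phi2 :
  rsum rho N (fun r => phi1 r + phi2 r) = rsum rho N phi1 + rsum rho N phi2.
Proof. by rewrite /rsum big_split mulrDr. Qed.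

Lemma rsumZ rho N c phi : rsum rho N (fun r => c * phi r) = c * rsum rho N phi.
Proof. by rewrite /rsum -mulr_sumr mulrCA. Qed.

Lemma eq_rsum rho N phi1 phi2 : 0 <= rho ->
  (forall r, rho <= r <= 2 * rho -> phi1 r = phi2 r) ->
  rsum rho N phi1 = rsum rho N phi2.
Proof.
move=> rho0 e; congr (_ * _); apply: eq_bigr => j _; apply: e; exact: rsum_node.
Qed.

Lemma ler_rsum rho N phi1 phi2 : 0 <= rho ->
  (forall r, rho <= r <= 2 * rho -> phi1 r <= phi2 r) ->
  rsum rho N phi1 <= rsum rho N phi2.
Proof.
move=> rho0 e; rewrite ler_wpM2l ?divr_ge0// ler_sum// => j _; apply: e.
exact: rsum_node.
Qed.

Lemma rsum_cst rho N c : rsum rho N (fun=> c) = rho * c.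
Proof. by rewrite /rsum sumr_const card_ord -[c *+ _]mulr_natl mulrA divfK. Qed.

Lemma ler_norm_rsum rho N phi M : 0 <= rho ->
  (forall r, rho <= r <= 2 * rho -> `|phi r| <= M) -> `|rsum rho N phi| <= rho * M.
Proof.
move=> rho0 pM; rewrite ler_norml -mulrN -!(rsum_cst rho N).
by rewrite !ler_rsum// => r /pM; rewrite ler_norml => /andP[].
Qed.

Definition annulus rho : set 'rV[R]_d := [set x | rho <= enorm x <= 2 * rho].

Lemma compact_annulus rho : compact (annulus rho).
Proof.
apply: bounded_closed_compact.
  exists (2 * rho); split; first exact: num_real.
  move=> M rM x /= /andP[_ x1].
  by rewrite (le_trans (ler_norm_enorm x))// (le_trans x1)// ltW.
have -> : annulus rho = (@enorm R d @^-1` [set y | rho <= y]) `&`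
    (@enorm R d @^-1` [set y | y <= 2 * rho]).
  by apply/seteqP; split=> x /= => [/andP[]|[? ?]] //; apply/andP.
apply: closedI; apply: closed_comp.
- by move=> x _; exact: continuous_enorm.
- exact: closed_ge.
- by move=> x _; exact: continuous_enorm.
- exact: closed_le.
Qed.

Lemma annulus_ray rho r theta : 0 <= rho -> sphere theta ->
  rho <= r <= 2 * rho -> annulus rho (r *: theta).
Proof.
move=> rho0 th1 rr; rewrite /annulus /= enormZ_sphere//.
by case/andP: rr => /(le_trans rho0).
Qed.

(** One mesh works for all directions [theta] and all primitives [Q], because [Phi] is uniformly
    continuous on the compact annulus. This uniformity lets a single radial mean be used on the
    whole sphere. *)
Lemma rsum_derivative rho (Phi : 'rV[R]_d -> R) (e : R) : 0 < rho -> 0 < e ->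
  (forall x, annulus rho x -> continuous_at x Phi) ->
  \forall N \near \oo, forall theta (Q : R -> R), sphere theta ->
    (forall r, rho <= r <= 2 * rho -> is_derive r 1 Q (Phi (r *: theta))) ->
    `|rsum rho N (fun r => Phi (r *: theta)) - (Q (2 * rho) - Q rho)| <= rho * e.
Proof.
move=> rho0 e0 cPhi.
have [r r0 rPhi] := compact_unif_continuous (@compact_annulus rho) cPhi e0.
near=> N => theta Q th1 dQ.
have two : 2 * rho - rho = rho by ring.
have := @riemann_sum_derivative R Q (fun r => Phi (r *: theta)) rho (2 * rho) e N.
rewrite two; apply => //.
  by rewrite ler_pMl// ler1n.
move=> s t ss tt st; apply: ltW; apply: rPhi; try exact: annulus_ray (ltW rho0) _ _.
rewrite -scalerBl normrZ (@le_lt_trans _ _ (rho / N.+1%:R))//.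
  rewrite -[leRHS]mulr1 ler_pM// (le_trans (ler_norm_enorm _))//.
  by rewrite [enorm _]th1.
rewrite ltr_pdivrMr// -ltr_pdivrMl// mulrC.
near: N; apply: filterS (nbhs_infty_gtr (rho / r)) => n /lt_trans; apply.
by rewrite ltr_nat.
Unshelve. all: by end_near. Qed.

End RadialSums.

(** * A polynomial bump in the radius *)

Section Bump.
Variable R : realType.
Implicit Types (rho r : R).

(** The double zeros at [rho] and [2 * rho] remove the boundary terms of two integrations by
    parts. *)
Definition bump rho r : R := ((r - rho) * (2 * rho - r)) ^+ 2.
Definition bump' rho r : R := 2 * ((r - rho) * (2 * rho - r)) * (3 * rho - 2 * r).
Definition bump'' rho r : R :=
  2 * (3 * rho - 2 * r) ^+ 2 - 4 * ((r - rho) * (2 * rho - r)).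

Lemma is_derive_bump rho r : is_derive r 1 (bump rho) (bump' rho r).
Proof.
rewrite /bump; apply: is_derive_eq; rewrite /bump' /GRing.scale /=; ring.
Qed.

Lemma is_derive_bump' rho r : is_derive r 1 (bump' rho) (bump'' rho r).
Proof.
rewrite /bump'; apply: is_derive_eq; rewrite /bump'' /GRing.scale /=; ring.
Qed.

Lemma continuous_bump'' rho : continuous (bump'' rho).
Proof.
move=> r; have : derivable (bump'' rho) r 1 by rewrite /bump''; apply: ex_derive.
by move=> /derivable1_diffP/differentiable_continuous.
Qed.

Lemma bump_ends rho : [/\ bump rho rho = 0, bump rho (2 * rho) = 0,
  bump' rho rho = 0 & bump' rho (2 * rho) = 0].
Proof. by rewrite /bump /bump' !subrr; split; ring. Qed.

Lemma bump_bounds rho r : 0 < rho -> rho <= r <= 2 * rho ->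
  [/\ 0 <= bump rho r <= rho ^+ 4, `|bump' rho r| <= 2 * rho ^+ 3 &
      `|bump'' rho r| <= 6 * rho ^+ 2].
Proof.
move=> rho0 /andP[r1 r2].
have : 0 <= (r - rho) * (2 * rho - r) <= rho ^+ 2.
  by rewrite mulr_ge0 ?subr_ge0//= expr2 ler_pM ?subr_ge0//; lra.
rewrite /bump /bump' /bump''; set q := (r - rho) * (2 * rho - r) => /andP[q0 q1].
have s1 : `|3 * rho - 2 * r| <= rho by rewrite ler_norml; lra.
have s2 : (3 * rho - 2 * r) ^+ 2 <= rho ^+ 2.
  by rewrite -real_normK ?num_real// ler_pXn2r// ?nnegrE// ltW.
split.
- rewrite sqr_ge0/= (_ : rho ^+ 4 = (rho ^+ 2) ^+ 2) -?exprM//.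
  by rewrite exprM ler_pXn2r// ?nnegrE// sqr_ge0.
- have t0 : 0 <= 2 * q by rewrite mulr_ge0.
  rewrite normrM (ger0_norm t0) (_ : 2 * rho ^+ 3 = 2 * rho ^+ 2 * rho); last by ring.
  by rewrite ler_pM// ler_wpM2l.
- by rewrite ler_norml; move: s2 (sqr_ge0 (3 * rho - 2 * r)) q0 q1; lra.
Qed.

End Bump.

(** * The rescaled wave and its radial flux *)

Section OutgoingWave.
Variables (R : realType) (d : nat) (kappa : R).
Implicit Types (alpha beta : R -> R) (a b : 'rV[R]_d -> R) (x theta : 'rV[R]_d).
Implicit Types (V : set 'rV[R]_d) (r rho : R).

Definition decay : R := (d%:R - 1) / 2.

(* The real part of e^(- i kappa r) r^((d - 1) / 2) (alpha + i beta). *)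
Definition osc alpha beta r : R :=
  r `^ decay * (cos (kappa * r) * alpha r + sin (kappa * r) * beta r).

(** The first term comes from the power of [r]. The last comes from the phase: multiplication by - i
    kappa turns alpha + i beta into kappa (beta - i alpha). *)
Lemma is_derive_osc alpha beta alpha' beta' r : 0 < r ->
  is_derive r 1 alpha (alpha' r) -> is_derive r 1 beta (beta' r) ->
  is_derive r 1 (osc alpha beta) (decay / r * osc alpha beta r +
    osc alpha' beta' r + kappa * osc beta (fun s => - alpha s) r).
Proof.
move=> r0 da db; have dw := is_derive1_powR decay r0.
have dk : is_derive r 1 (fun s => kappa * s) kappa.
  by apply: is_derive_eq; rewrite /GRing.scale /= mulr1.
have dc := is_derive1_comp (is_derive_cos (kappa * r)) dk.
have ds := is_derive1_comp (is_derive_sin (kappa * r)) dk.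
have E : osc alpha beta = ((fun s : R => s `^ decay) : R -> R) *
    (((cos \o (fun s => kappa * s)) : R -> R) * alpha +
     ((sin \o (fun s => kappa * s)) : R -> R) * beta) by [].
rewrite E; apply: is_derive_eq; rewrite /osc /GRing.scale /= !fctE /=.
have -> : r `^ (decay - 1) = r `^ decay / r.
  by rewrite powRB ?powRr1 ?(ltW r0)// (gt_eqF r0) implybT.
by field; rewrite gt_eqF.
Qed.

(** The real part of e^(- i kappa |x|) |x|^decay (a + i b). The imaginary part is the same
    expression with [b] and [- a] in place of [a] and [b]. *)
Definition wave a b x : R :=
  enorm x `^ decay * (cos (kappa * enorm x) * a x + sin (kappa * enorm x) * b x).

Lemma wave_ray a b theta r : 0 <= r -> sphere theta ->
  wave a b (r *: theta) = osc (fun s => a (s *: theta)) (fun s => b (s *: theta)) r.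
Proof. by move=> r0 th1; rewrite /wave enormZ_sphere. Qed.

Lemma continuous_at_comp_enorm (phi : R -> R) x :
  continuous_at (enorm x) phi -> continuous_at x (fun y => phi (enorm y)).
Proof.
move=> cphi; apply: (@continuous_comp _ _ _ (@enorm R d) phi) => //.
exact: continuous_enorm.
Qed.

Lemma is_derive_continuous (phi : R -> R) r l :
  is_derive r 1 phi l -> continuous_at r phi.
Proof. by move=> [/derivable1_diffP/differentiable_continuous + _]. Qed.

Lemma continuous_at_wave a b x : x != 0 -> continuous_at x a -> continuous_at x b ->
  continuous_at x (wave a b).
Proof.
move=> /enorm_gt0 x0 ca cb; rewrite /wave.
have dk : is_derive (enorm x) 1 (fun s => kappa * s) kappa.
  by apply: is_derive_eq; rewrite /GRing.scale /= mulr1.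
apply: continuous_atM.
  apply: (@continuous_at_comp_enorm (fun s : R => s `^ decay)).

  exact: is_derive_continuous (is_derive1_powR decay x0).
apply: continuous_atD; apply: continuous_atM => //.
  apply: (@continuous_at_comp_enorm (cos \o (fun s => kappa * s))).
  exact: is_derive_continuous (is_derive1_comp (is_derive_cos _) dk).
apply: (@continuous_at_comp_enorm (sin \o (fun s => kappa * s))).
exact: is_derive_continuous (is_derive1_comp (is_derive_sin _) dk).
Qed.

Definition radial1 a x : R := gradient_form a x (direction x).
Definition radial2 a x : R := hessian_form a x (direction x).

Lemma continuous_at_direction x i : x != 0 -> continuous_at x (fun y => direction y 0 i).
Proof.
move=> x0; rewrite [X in continuous_at x X](_ : _ = fun y => (enorm y)^-1 * y 0 i); last first.
  by apply/funext => y; rewrite mxE.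
apply: continuous_atM; last exact: coord_continuous.
apply: continuous_atV; last exact: continuous_enorm.
by rewrite gt_eqF// enorm_gt0.
Qed.

Lemma continuous_at_radial1 V a x : class_C 1 V a -> V x -> x != 0 ->
  continuous_at x (radial1 a).
Proof.
move=> [_ aC] Vx x0; apply: continuous_at_sum => i; apply: continuous_atM.
  exact: continuous_at_direction.
by have [_ [ci _]] := aC i; apply: ci; rewrite inE.
Qed.

Lemma continuous_at_radial2 V a x : class_C 2 V a -> V x -> x != 0 ->
  continuous_at x (radial2 a).
Proof.
move=> aC Vx x0; apply: continuous_at_sum => i; apply: continuous_atM.
  exact: continuous_at_direction.
exact: continuous_at_radial1 (class_C2_partial i aC) Vx x0.
Qed.

(* For a solution of the Helmholtz equation this is the spherical Laplacian,
   read off the radial derivatives. *)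
Definition sphere_laplacian a x : R :=
  - (kappa ^+ 2 * enorm x ^+ 2 * a x + enorm x ^+ 2 * radial2 a x +
     2 * decay * enorm x * radial1 a x).

Lemma continuous_at_sphere_laplacian V a x : class_C 2 V a -> V x -> x != 0 ->
  continuous_at x (sphere_laplacian a).
Proof.
move=> aC Vx x0.
have ce : continuous_at x (fun y => enorm y ^+ 2).
  apply: (@continuous_at_comp_enorm (fun s => s ^+ 2)); exact: exprn_continuous.
have ca : continuous_at x a by have [+ _] := aC; apply; rewrite inE.
rewrite /sphere_laplacian.
rewrite [X in continuous_at x X](_ : _ =
  (fun y => -1 * (kappa ^+ 2 * (enorm y ^+ 2 * a y) +
  enorm y ^+ 2 * radial2 a y + 2 * decay * (enorm y * radial1 a y)))); last first.
  by apply/funext => y; ring.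
apply: continuous_atMl; apply: continuous_atD; first apply: continuous_atD.
- by apply: continuous_atMl; exact: continuous_atM.
- by apply: continuous_atM => //; exact: continuous_at_radial2 aC Vx x0.
- apply: continuous_atMl; apply: continuous_atM; first exact: continuous_enorm.
  exact: continuous_at_radial1 (class_CS aC) Vx x0.
Qed.

(** The coefficient of the 1 / r^2 potential that appears when r^(- decay) is factored out of the
    solution. *)
Definition centrifugal : R := decay ^+ 2 - decay.

(** With p the bump and g the complex rescaled wave, this is the real part of p r^(-2) ((m^2 - m) g
    - L g) + 2 i kappa p' g - p'' g, where m = [decay]. *)
Definition radial_flux_derivative rho a b x : R :=
  - 1 * (bump rho (enorm x) * (enorm x)^-2 *
    wave (sphere_laplacian a) (sphere_laplacian b) x) -
  bump'' rho (enorm x) * wave a b x -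
  2 * kappa * (bump' rho (enorm x) * wave b (fun y => - 1 * a y) x) +
  centrifugal * (bump rho (enorm x) * (enorm x)^-2 * wave a b x).

Lemma continuous_at_radial_flux_derivative V rho a b x :
  class_C 2 V a -> class_C 2 V b -> V x -> x != 0 ->
  continuous_at x (radial_flux_derivative rho a b).
Proof.
move=> aC bC Vx x0.
have ca : continuous_at x a by have [+ _] := aC; apply; rewrite inE.
have cb : continuous_at x b by have [+ _] := bC; apply; rewrite inE.
have cna : continuous_at x (fun y => - 1 * a y) by exact: continuous_atMl.
have cp : continuous_at x (fun y => bump rho (enorm y)).
  apply: continuous_at_comp_enorm; exact: is_derive_continuous (is_derive_bump _ _).
have cp' : continuous_at x (fun y => bump' rho (enorm y)).
  apply: continuous_at_comp_enorm; exact: is_derive_continuous (is_derive_bump' _ _).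
have cp'' : continuous_at x (fun y => bump'' rho (enorm y)).
  apply: continuous_at_comp_enorm; exact: continuous_bump''.
have ci : continuous_at x (fun y => (enorm y)^-2).
  apply: (@continuous_atV _ _ _ (fun y => enorm y ^+ 2)).
    by rewrite sqrf_eq0 gt_eqF// enorm_gt0.
  apply: (@continuous_at_comp_enorm (fun s => s ^+ 2)); exact: exprn_continuous.
apply: continuous_atD; first apply: continuous_atB; first apply: continuous_atB.
- apply: continuous_atMl; apply: continuous_atM; first exact: continuous_atM.
  apply: continuous_at_wave => //.
    exact: continuous_at_sphere_laplacian aC Vx x0.
  exact: continuous_at_sphere_laplacian bC Vx x0.
- by apply: continuous_atM => //; exact: continuous_at_wave.
- by apply: continuous_atMl; apply: continuous_atM => //; exact: continuous_at_wave.
- apply: continuous_atMl; apply: continuous_atM; first exact: continuous_atM.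
  exact: continuous_at_wave.
Qed.

(* Its integral over [rho, 2 rho] vanishes because the bump and its derivative do
   at both ends; its derivative trades the weighted spherical Laplacian of the
   wave for undifferentiated terms. *)
Definition radial_flux rho alpha beta alpha' beta' r : R :=
  bump rho r * (decay / r * osc alpha beta r + osc alpha' beta' r -
    kappa * osc beta (fun s => - alpha s) r) - bump' rho r * osc alpha beta r.

(** The flux is the real part of p (g_r + 2 i kappa g) - p' g. Since [sphere_laplacian] is expressed
    by radial derivatives, the identity is a computation in [r] alone. *)
Lemma is_derive_radial_flux V rho a b theta r : open V ->
  class_C 2 V a -> class_C 2 V b -> sphere theta -> 0 < r -> V (r *: theta) ->
  is_derive r 1 (radial_flux rho (fun s => a (s *: theta)) (fun s => b (s *: theta))
     (fun s => gradient_form a (s *: theta) theta)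
     (fun s => gradient_form b (s *: theta) theta))
   (radial_flux_derivative rho a b (r *: theta)).
Proof.
move=> oV aC bC th1 r0 Vr.
pose al s := a (s *: theta); pose be s := b (s *: theta).
pose al1 s := gradient_form a (s *: theta) theta.
pose be1 s := gradient_form b (s *: theta) theta.
pose al2 s := hessian_form a (s *: theta) theta.
pose be2 s := hessian_form b (s *: theta) theta.
have da : is_derive r 1 al (al1 r) := is_derive_ray oV (class_CS aC) Vr.
have db : is_derive r 1 be (be1 r) := is_derive_ray oV (class_CS bC) Vr.
have dna : is_derive r 1 (fun s => - al s) (- al1 r) := is_deriveN da.
have dda : is_derive r 1 al1 (al2 r) := is_derive_ray2 oV aC Vr.
have ddb : is_derive r 1 be1 (be2 r) := is_derive_ray2 oV bC Vr.
have dU := is_derive_osc r0 da db.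
have dV := @is_derive_osc _ _ be1 (fun s => - al1 s) _ r0 db dna.
have dA := is_derive_osc r0 dda ddb.
have dp := is_derive_bump rho r.
have dp' := is_derive_bump' rho r.
have dinv : is_derive r 1 (fun s : R => s^-1) (- r ^- 2).
  have := @is_deriveV R id r 1 1 (lt0r_neq0 r0) (is_derive_id _ _).
  by rewrite /GRing.scale /= mulr1.
rewrite /radial_flux -/al -/be -/al1 -/be1.
have E : (fun s => bump rho s * (decay / s * osc al be s + osc al1 be1 s -
    kappa * osc be (fun t => - al t) s) - bump' rho s * osc al be s) =
  bump rho * ((decay *: (fun s : R => s^-1)) * osc al be + osc al1 be1 -
    kappa *: osc be (fun t => - al t)) - bump' rho * osc al be by [].
rewrite [X in is_derive _ _ X _]E; apply: is_derive_eq.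
rewrite /radial_flux_derivative !wave_ray ?(ltW r0)// enormZ_sphere ?(ltW r0)//.
rewrite /osc /sphere_laplacian /radial1 /radial2 /centrifugal /GRing.scale /=.
rewrite !direction_ray// !enormZ_sphere ?(ltW r0)// -!/(al _) -!/(be _).
rewrite -/(al r) -/(be r) -/(al1 r) -/(be1 r) -/(al2 r) -/(be2 r) !fctE /=.
rewrite /GRing.scale /=; by field; rewrite gt_eqF.
Qed.

End OutgoingWave.

(** * Lipschitz continuity of the far-field pattern *)

Section FarFieldRegularity.
Variables (R : realType) (d : nat) (kappa R0 C : R) (V : set 'rV[R]_d).
Variables (a b fu fv : 'rV[R]_d -> R).
Implicit Types (x theta n : 'rV[R]_d) (r rho : R) (f : 'rV[R]_d -> R) (N : nat).
Hypotheses (d_ge2 : (2 <= d)%N) (R0_gt0 : 0 < R0) (openV : open V).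
Hypothesis outside : forall x, R0 <= enorm x -> V x.
Hypotheses (aC : class_C 2 V a) (bC : class_C 2 V b).
Hypothesis a_helmholtz : forall x, V x -> real_laplacian a x = - kappa ^+ 2 * a x.
Hypothesis b_helmholtz : forall x, V x -> real_laplacian b x = - kappa ^+ 2 * b x.
Local Notation U := (wave kappa a b).
Local Notation W := (wave kappa b (fun y => - 1 * a y)).
Hypothesis U_far : forall r theta, R0 <= r -> sphere theta ->
  `|U (r *: theta) - fu theta| <= C / r.
Hypothesis W_far : forall r theta, R0 <= r -> sphere theta ->
  `|W (r *: theta) - fv theta| <= C / r.

Let ray_in r theta : R0 <= r -> sphere theta -> V (r *: theta).
Proof.
by move=> rR0 th1; apply: outside; rewrite enormZ_sphere// (le_trans (ltW R0_gt0)).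
Qed.

Let neq0 x : R0 <= enorm x -> x != 0.
Proof.
move=> xR0; apply: contraTneq xR0 => ->.
by rewrite /enorm dot0l sqrtr0 -ltNge.
Qed.

Let cont_at f x : class_C 2 V f -> V x -> continuous_at x f.
Proof. by move=> [+ _] Vx; apply; rewrite inE. Qed.

(** At the single radius [R0] the wave is bounded by compactness, and [g] differs from it there by
    at most [C / R0]. *)
Lemma wave_far_bounded (al be g : 'rV[R]_d -> R) :
  (forall x, V x -> continuous_at x al) -> (forall x, V x -> continuous_at x be) ->
  (forall r theta, R0 <= r -> sphere theta ->
    `|wave kappa al be (r *: theta) - g theta| <= C / r) ->
  exists2 M : R, 0 < M & forall theta, sphere theta -> `|g theta| <= M.
Proof.
move=> cal cbe gfar.
have /ex_strict_bound_gt0[k k0 /= kb] : bounded_set (wave kappa al be @` annulus R0).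
  apply/compact_bounded/continuous_compact; last exact: compact_annulus.
  apply: continuous_in_subspaceT => x /set_mem /andP[xR0 _].
  by apply: continuous_at_wave; [exact: neq0|exact/cal/outside|exact/cbe/outside].
exists (k + `|C / R0|); first by rewrite ltr_pwDl.
move=> theta th1.
have an : annulus R0 (R0 *: theta).
  by apply: annulus_ray => //; rewrite ?(ltW R0_gt0)// lexx ler_peMl ?(ltW R0_gt0)// ler1n.
have := kb (wave kappa al be (R0 *: theta)) (ex_intro2 _ _ _ an erefl).
have := gfar R0 theta (lexx _) th1.
set w := wave _ _ _ _ => h1 h2.
rewrite -[g theta](subKr w) (le_trans (ler_normB _ _))// lerD// ?(ltW h2)//.
exact: le_trans h1 (ler_norm _).
Qed.

Definition radial_weight rho r : R := bump rho r * r ^- 2.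

(** The oscillating factors involve [r] and not [enorm (r *: x)]. This agrees with the mean of
    [wave] on the unit sphere, and it is a finite linear combination of dilations of [a] and [b],
    whose spherical Laplacian is computed termwise. *)
Definition radial_mean rho N (x : 'rV[R]_d) : R :=
  rsum rho N (fun r => radial_weight rho r *
    (r `^ decay R d * cos (kappa * r) * a (r *: x) +
     r `^ decay R d * sin (kappa * r) * b (r *: x))).

Lemma radial_meanE rho N x : 0 < rho -> sphere x ->
  radial_mean rho N x = rsum rho N (fun r => radial_weight rho r * U (r *: x)).
Proof.
move=> rho0 x1; apply: eq_rsum; first exact: ltW.
move=> r /andP[r1 _]; have r0 := le_trans (ltW rho0) r1.
by rewrite wave_ray// /osc; ring.
Qed.

Lemma continuous_at_radial_mean rho N x : R0 <= rho -> sphere x ->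
  continuous_at x (radial_mean rho N).
Proof.
move=> rhoR0 x1; apply: continuous_atMl; apply: continuous_at_sum => j.
have rho0 : 0 <= rho by rewrite (le_trans (ltW R0_gt0)).
set r := rho + _.
have rR0 : R0 <= r by have /andP[+ _] := rsum_node j rho0; exact: le_trans.
have comp f : class_C 2 V f -> continuous_at x (fun y => f (r *: y)).
  move=> fC; apply: (@continuous_comp 'rV[R]_d 'rV[R]_d R (fun y => r *: y) f x).
    exact: scaler_continuous.
  by apply: (cont_at fC); exact: ray_in.
apply: continuous_atMl; apply: continuous_atD; apply: continuous_atMl; exact: comp.
Qed.

(** The Helmholtz equation enters here: it replaces the full Laplacian in the polar formula, leaving
    the radial expression [sphere_laplacian]. *)
Lemma spherical_laplacian_radial_mean rho N n x : R0 <= rho ->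
  dot n n *: n = n -> sphere x ->
  has_spherical_laplacian (fun y => radial_mean rho N (reflection n y)) x
    (rsum rho N (fun r => radial_weight rho r *
      wave kappa (sphere_laplacian kappa a) (sphere_laplacian kappa b)
        (r *: reflection n x))).
Proof.
move=> rhoR0 nn x1; have w1 := sphere_reflection nn x1.
have rho0 : 0 <= rho by rewrite (le_trans (ltW R0_gt0)).
apply: spherical_laplacianZ; apply: spherical_laplacian_sum => j.
set r := rho + _.
have rR0 : R0 <= r by have /andP[+ _] := rsum_node j rho0; exact: le_trans.
clearbody r; have r0 : 0 < r := lt_le_trans R0_gt0 rR0.
have lapE f : class_C 2 V f ->
    (forall x, V x -> real_laplacian f x = - kappa ^+ 2 * f x) ->
    has_spherical_laplacian (fun y => f (r *: reflection n y)) x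
      (sphere_laplacian kappa f (r *: reflection n x)).
  move=> fC fh; have := @spherical_laplacian_sphere R d V f n x r openV fC nn x1.
  move=> /(_ (fun y => @ray_in r y rR0)) /=; rewrite fh; last exact: ray_in.
  rewrite [X in has_spherical_laplacian _ _ X -> _](_ : _ =
    sphere_laplacian kappa f (r *: reflection n x))//.
  rewrite /sphere_laplacian /radial1 /radial2 direction_ray// enormZ_sphere ?(ltW r0)//.
  by rewrite /decay; field.
apply: spherical_laplacianZ; rewrite wave_ray ?(ltW r0)// /osc mulrDr !mulrA.
by apply: spherical_laplacianD; apply: spherical_laplacianZ; exact: lapE.
Qed.


Let weight_bounds rho r : 0 < rho -> rho <= r <= 2 * rho ->
  bump rho r / (4 * rho ^+ 2) <= radial_weight rho r /\
  0 <= radial_weight rho r <= rho ^+ 2.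
Proof.
move=> rho0 rr; have [/andP[p0 p1] _ _] := bump_bounds rho0 rr.
move/andP: rr => [r1 r2]; have r0 := lt_le_trans rho0 r1.
rewrite /radial_weight; split.
  rewrite ler_wpM2l// lef_pV2 ?posrE ?mulr_gt0 ?exprn_gt0//.
  rewrite (_ : 4 * rho ^+ 2 = (2 * rho) ^+ 2); last by ring.
  by rewrite ler_pXn2r// nnegrE; lra.
apply/andP; split; first by rewrite divr_ge0// exprn_ge0// ltW.
rewrite ler_pdivrMr ?exprn_gt0//.
rewrite (le_trans p1)// (_ : rho ^+ 4 = rho ^+ 2 * rho ^+ 2); last by ring.
by rewrite ler_wpM2l ?exprn_ge0 ?(ltW rho0)// ler_pXn2r// nnegrE ltW.
Qed.

Lemma rsum_enorm (phi dphi : R -> R) rho e : 0 < rho -> 0 < e ->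
  (forall r, is_derive r 1 phi (dphi r)) -> (forall r, continuous_at r dphi) ->
  \forall N \near \oo, `|rsum rho N dphi - (phi (2 * rho) - phi rho)| <= rho * e.
Proof.
move=> rho0 e0 dp cp.
(* Any unit vector will do; along its ray, a function of the norm is a function of [r]. *)
have [z [_ z1]] := @hyperplane_unit R d 0 d_ge2.
have cphi x : annulus rho x -> continuous_at x (fun y => dphi (enorm y)).
  by move=> _; apply: continuous_at_comp_enorm.
have := rsum_derivative rho0 e0 cphi; apply: filterS => N /(_ z phi z1).
rewrite (@eq_rsum R rho N (fun r => dphi (enorm (r *: z))) dphi) ?(ltW rho0)//.
  apply=> r /andP[r1 _]; rewrite enormZ_sphere// (le_trans (ltW rho0))//.
by move=> r /andP[r1 _]; rewrite enormZ_sphere// (le_trans (ltW rho0)).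
Qed.

(** The bump has integral rho^5 / 30. A Riemann error of at most rho^5 / 60 leaves rho^5 / 60, and
    dividing by r^2 <= 4 rho^2 gives rho^3 / 240. *)
Lemma rsum_weight_lower rho : 0 < rho ->
  \forall N \near \oo, rho ^+ 3 / 240 <= rsum rho N (radial_weight rho).
Proof.
move=> rho0.
pose S r : R :=
  rho ^+ 2 * (r - rho) ^+ 3 / 3 - rho * (r - rho) ^+ 4 / 2 + (r - rho) ^+ 5 / 5.
have dS r : is_derive r 1 S (bump rho r).
  by rewrite /S; apply: is_derive_eq; rewrite /bump /GRing.scale /=; field.
have cb r : continuous_at r (bump rho).
  exact: is_derive_continuous (is_derive_bump _ _).
have e0 : 0 < rho ^+ 4 / 60 by rewrite divr_gt0// exprn_gt0.
have := rsum_enorm rho0 e0 dS cb; apply: filterS => N.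
have -> : S (2 * rho) - S rho = rho ^+ 5 / 30 by rewrite /S; field.
rewrite ler_distl => /andP[h _].
apply: (@le_trans _ _ (rsum rho N (fun r => (4 * rho ^+ 2)^-1 * bump rho r))); last first.
  apply: ler_rsum => [|r rr]; first exact: ltW.
  by rewrite mulrC; have [] := weight_bounds rho0 rr.
rewrite rsumZ -ler_pdivrMl ?invr_gt0 ?mulr_gt0 ?exprn_gt0// invrK.
by apply: le_trans h; rewrite le_eqVlt; apply/orP; left; apply/eqP; field.
Qed.

(** The flux has zero total increment, so the weighted Laplacian is traded for terms with p'', p'
    and the centrifugal weight. Since p' and p'' also have integral zero, only the differences of
    the waves from [fu] and [fv] count there, and everything is O(rho^3), the order of the total
    weight. *)
Lemma rsum_sphere_laplacian_bound (M : R) rho : R0 <= rho -> 1 <= rho ->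
  (forall theta, sphere theta -> `|fu theta| <= M /\ `|fv theta| <= M) ->
  \forall N \near \oo, forall theta, sphere theta ->
    `|rsum rho N (fun r => radial_weight rho r *
       wave kappa (sphere_laplacian kappa a) (sphere_laplacian kappa b) (r *: theta))| <=
    rho ^+ 3 * (1 + 6 * C + 4 * `|kappa| * C + `|centrifugal R d| * (M + C) +
                M + 2 * `|kappa| * M).
Proof.
move=> rhoR0 rho1 fM; have rho0 : 0 < rho := lt_le_trans ltr01 rho1.
have C0 : 0 <= C.
  have [z [_ z1]] := @hyperplane_unit R d 0 d_ge2.
  have := le_trans (normr_ge0 _) (U_far (lexx R0) z1).
  by rewrite pmulr_lge0 ?invr_gt0.
(* With this tolerance each of the three Riemann sums below has error at most rho^3. *)
have e0 : 0 < rho ^+ 2 by rewrite exprn_gt0.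
have cflux x : annulus rho x -> continuous_at x (radial_flux_derivative kappa rho a b).
  move=> /andP[xr _]; have xR0 := le_trans rhoR0 xr.
  exact: continuous_at_radial_flux_derivative aC bC (outside xR0) (neq0 xR0).
have cb' r : continuous_at r (bump' rho).
  exact: is_derive_continuous (is_derive_bump' _ _).
have flux0 := rsum_derivative rho0 e0 cflux.
have bump0 := rsum_enorm rho0 e0 (is_derive_bump rho) cb'.
have bump'0 := rsum_enorm rho0 e0 (is_derive_bump' rho) (@continuous_bump'' R rho).
move: flux0 bump0 bump'0; apply: filterS3 => N flux0 bump0 bump'0 theta th1.
have [fuM fvM] := fM theta th1.
have [p1 p2 p3 p4] := bump_ends rho.
have h1 : `|rsum rho N (fun r => radial_flux_derivative kappa rho a b (r *: theta))| <=
    rho ^+ 3.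
  pose Q := radial_flux d kappa rho (fun s => a (s *: theta)) (fun s => b (s *: theta))
    (fun s => gradient_form a (s *: theta) theta)
    (fun s => gradient_form b (s *: theta) theta).
  have Q0 : Q (2 * rho) - Q rho = 0 by rewrite /Q /radial_flux p1 p2 p3 p4 !mul0r !subr0.
  have dQ r : rho <= r <= 2 * rho ->
      is_derive r 1 Q (radial_flux_derivative kappa rho a b (r *: theta)).
    move=> /andP[r1 _]; have rR0 := le_trans rhoR0 r1.
    have r0 := lt_le_trans R0_gt0 rR0.
    exact: is_derive_radial_flux openV aC bC th1 r0 (ray_in rR0 th1).
  by have := flux0 theta Q th1 dQ; rewrite Q0 subr0 -exprS.
have h2 : `|rsum rho N (bump' rho)| <= rho ^+ 3.
  by have := bump0; rewrite p1 p2 subrr subr0 -exprS; apply.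
have h3 : `|rsum rho N (bump'' rho)| <= rho ^+ 3.
  by have := bump'0; rewrite p3 p4 subrr subr0 -exprS; apply.
pose rest r : R := - 1 * (bump'' rho r * (U (r *: theta) - fu theta)) +
  - 1 * (2 * kappa * (bump' rho r * (W (r *: theta) - fv theta))) +
  centrifugal R d * (radial_weight rho r * U (r *: theta)).
have h4 : `|rsum rho N rest| <= rho * (rho ^+ 2 * (6 * C + 4 * `|kappa| * C +
    `|centrifugal R d| * (M + C))).
  apply: ler_norm_rsum => [|r rr]; first exact: ltW.
  have [_ b1 b2] := bump_bounds rho0 rr; have [_ /andP[w0 w1]] := weight_bounds rho0 rr.
  move/andP: rr => [r1 r2]; have rR0 := le_trans rhoR0 r1.
  have r0 : 0 < r := lt_le_trans rho0 r1.
  have u1 := U_far rR0 th1; have v1 := W_far rR0 th1.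
  have cr : C / r <= C / rho by rewrite ler_wpM2l// lef_pV2.
  have crho : C / rho <= C by rewrite ler_pdivrMr// ler_peMr.
  have t1 : `|- 1 * (bump'' rho r * (U (r *: theta) - fu theta))| <= 6 * rho ^+ 2 * C.
    rewrite mulN1r normrN normrM ler_pM//.
    exact: le_trans u1 (le_trans cr crho).
  (* The critical term: p' is of order rho^3, so summing over a length rho would give rho^4. The
     rate [C / r] gains back the missing power. *)
  have t2 : `|- 1 * (2 * kappa * (bump' rho r * (W (r *: theta) - fv theta)))| <=
      2 * `|kappa| * (2 * rho ^+ 3 * (C / rho)).
    rewrite mulN1r normrN (normrM (2 * kappa)) (normrM 2) (normrM (bump' rho r)).
    by rewrite (ger0_norm (ler0n _ 2)) ler_wpM2l ?mulr_ge0// ler_pM// (le_trans v1).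
  have t2' : 2 * `|kappa| * (2 * rho ^+ 3 * (C / rho)) = 4 * `|kappa| * rho ^+ 2 * C.
    by field; rewrite gt_eqF.
  have t3 : `|centrifugal R d * (radial_weight rho r * U (r *: theta))| <=
      `|centrifugal R d| * (rho ^+ 2 * (M + C)).
    rewrite normrM ler_wpM2l// normrM ler_pM// ?(ger0_norm w0)//.
    rewrite -[U _](subrK (fu theta)) addrC (le_trans (ler_normD _ _))// lerD//.
    exact: le_trans u1 (le_trans cr crho).
  rewrite /rest (le_trans (ler_normD _ _))//.
  have := ler_normD (- 1 * (bump'' rho r * (U (r *: theta) - fu theta)))
    (- 1 * (2 * kappa * (bump' rho r * (W (r *: theta) - fv theta)))).
  move: t1 t2 t3; rewrite t2' => t1 t2 t3 t4.
  move: (le_trans t4 (lerD t1 t2)) t3; lra.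
have E : rsum rho N (fun r => radial_weight rho r *
       wave kappa (sphere_laplacian kappa a) (sphere_laplacian kappa b) (r *: theta)) =
  - 1 * rsum rho N (fun r => radial_flux_derivative kappa rho a b (r *: theta)) +
  rsum rho N rest + - fu theta * rsum rho N (bump'' rho) +
  - (2 * kappa * fv theta) * rsum rho N (bump' rho).
  rewrite -!rsumZ -!rsumD; apply: eq_rsum => [|r /andP[r1 _]]; first exact: ltW.
  have r0 := le_trans (ltW rho0) r1.
  rewrite /radial_flux_derivative !enormZ_sphere// /rest /radial_weight.
  by ring.
rewrite E.
have M0 : 0 <= M by exact: le_trans fuM.
have n1 : `|- fu theta * rsum rho N (bump'' rho)| <= M * rho ^+ 3.
  by rewrite (normrM (- fu theta)) normrN ler_pM.
have n2 : `|- (2 * kappa * fv theta) * rsum rho N (bump' rho)| <=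
    2 * `|kappa| * M * rho ^+ 3.
  have -> : 2 * `|kappa| * M * rho ^+ 3 = `|2 * kappa| * M * rho ^+ 3.
    by rewrite normrM (ger0_norm (ler0n _ 2)).
  by rewrite (normrM (- _)) normrN (normrM (2 * kappa)) ler_pM ?mulr_ge0// ler_wpM2l.
rewrite (le_trans (ler_normD _ _))// (le_trans (lerD (ler_normD _ _) n2))//.
have := ler_normD
  (- 1 * rsum rho N (fun r => radial_flux_derivative kappa rho a b (r *: theta)))
  (rsum rho N rest).
rewrite mulN1r normrN => n3.
have := le_trans n3 (lerD h1 h4) => n4.
move: (lerD n4 n1); rewrite mulrA -exprS; lra.
Qed.

(** The mean is Lipschitz with constant of order rho^3, and divided by the total weight, also of
    order rho^3, it is within [C / rho] of [fu]. The resulting constant is independent of [rho],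
    which is then taken large. *)
Lemma far_field_lipschitz :
  exists2 K : R, 0 <= K & forall x y, sphere x -> sphere y ->
    fu x - fu y <= K * enorm (x - y).
Proof.
have [M1 M1_gt0 fuM] := wave_far_bounded
  (fun x Vx => cont_at aC Vx) (fun x Vx => cont_at bC Vx) U_far.
have cna x : V x -> continuous_at x (fun y => - 1 * a y).
  by move=> Vx; apply: continuous_atMl; exact: cont_at aC Vx.
have [M2 M2_gt0 fvM] := wave_far_bounded (fun x Vx => cont_at bC Vx) cna W_far.
have C0 : 0 <= C.
  have [z [_ z1]] := @hyperplane_unit R d 0 d_ge2.
  have := le_trans (normr_ge0 _) (U_far (lexx R0) z1).
  by rewrite pmulr_lge0 ?invr_gt0.
pose M : R := M1 + M2; have M0 : 0 <= M by rewrite addr_ge0// ltW.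
have fM theta : sphere theta -> `|fu theta| <= M /\ `|fv theta| <= M.
  move=> th1; split.
    by rewrite (le_trans (fuM _ th1))// lerDl ltW.
  by rewrite (le_trans (fvM _ th1))// lerDr ltW.
pose B := 1 + 6 * C + 4 * `|kappa| * C + `|centrifugal R d| * (M + C) + M +
  2 * `|kappa| * M.
have B0 : 0 < B.
  have := mulr_ge0 (normr_ge0 (centrifugal R d)) (addr_ge0 M0 C0).
  have := mulr_ge0 (normr_ge0 kappa) C0; have := mulr_ge0 (normr_ge0 kappa) M0.
  by rewrite /B; lra.
(* 720 is 3, from the Lipschitz lemma on the sphere, times 240, from the lower bound on the total
   weight. *)
exists (720 * B) => [|x y x1 y1].
  by apply: mulr_ge0; [exact: ler0n|exact: ltW].
apply/ler_addgt0Pr => e e0.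
(* The last entry makes the two approximation errors [C / rho], at [x] and at [y], add up to at most
   [e]. *)
pose rho : R := Num.max (Num.max 1 R0) (2 * C / e).
have rho1 : 1 <= rho by rewrite !le_max lexx.
have rhoR0 : R0 <= rho by rewrite !le_max lexx orbT.
have rhoC : 2 * C / e <= rho by rewrite !le_max lexx !orbT.
have rho0 : 0 < rho := lt_le_trans ltr01 rho1.
have [N [lapN wN]] : exists N : nat, (forall theta, sphere theta ->
    `|rsum rho N (fun r => radial_weight rho r *
       wave kappa (sphere_laplacian kappa a) (sphere_laplacian kappa b) (r *: theta))| <=
    rho ^+ 3 * B) /\ rho ^+ 3 / 240 <= rsum rho N (radial_weight rho).
  near \oo => N; exists N; split; near: N.
    exact: rsum_sphere_laplacian_bound rhoR0 rho1 fM.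
  exact: rsum_weight_lower.
have rB : 0 < rho ^+ 3 * B by rewrite mulr_gt0// exprn_gt0.
have lip := @spherical_lipschitz R d (radial_mean rho N) (rho ^+ 3 * B) d_ge2 rB
  (fun z z1 => continuous_at_radial_mean (N := N) rhoR0 z1) _ x y x1 y1.
have {}lip : radial_mean rho N x - radial_mean rho N y <=
    3 * (rho ^+ 3 * B) * enorm (x - y).
  apply: lip => n z nn z1; eexists.
    exact: spherical_laplacian_radial_mean rhoR0 nn z1.
  by apply: lapN; exact: sphere_reflection.
set T := rsum rho N (radial_weight rho) in wN.
have meanT z : sphere z -> `|radial_mean rho N z - fu z * T| <= T * (C / rho).
  move=> z1; rewrite radial_meanE// -mulNr /T -rsumZ -rsumD mulrC.
  have -> : C / rho * rsum rho N (radial_weight rho) =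
    rsum rho N (fun r => C / rho * radial_weight rho r) by rewrite rsumZ.
  rewrite /rsum; rewrite normrM ger0_norm ?divr_ge0 ?(ltW rho0)//.
  rewrite ler_wpM2l ?divr_ge0 ?(ltW rho0)//.
  rewrite (le_trans (ler_norm_sum _ _ _))// ler_sum// => j _.
  have := rsum_node j (ltW rho0); set r := rho + _ => rr.
  have [_ /andP[w0 _]] := weight_bounds rho0 rr.
  move/andP: rr => [r1 _]; rewrite mulNr [fu z * _]mulrC -mulrBr normrM ger0_norm//.
  rewrite mulrC ler_wpM2r//; apply: le_trans (U_far (le_trans rhoR0 r1) z1) _.
  have r0 : 0 < r := lt_le_trans rho0 r1.
  by rewrite ler_wpM2l// lef_pV2 ?posrE.
have T0 : 0 < T.
  by apply: lt_le_trans wN; apply: divr_gt0; [exact: exprn_gt0|rewrite ltr0n].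
have crho : 2 * (C / rho) <= e.
  by rewrite mulrA ler_pdivrMr// [e * _]mulrC -ler_pdivrMr.
move: (meanT x x1) (meanT y y1); rewrite !ler_norml => /andP[x2 _] /andP[_ y2].
rewrite -(ler_pM2r T0).
apply: (@le_trans _ _ (3 * (rho ^+ 3 * B) * enorm (x - y) + 2 * (C / rho) * T)).
  move: lip x2 y2; lra.
rewrite [leRHS]mulrDl lerD//; last by rewrite ler_wpM2r// ltW.
have := ler_wpM2l (mulr_ge0 (ltW B0) (enorm_ge0 (x - y))) wN; lra.
Unshelve. all: by end_near. Qed.

End FarFieldRegularity.

(** * Geometry of the two points *)

Lemma ler_dist_sin (R : realType) (x y : R) : `|sin x - sin y| <= `|x - y|.
Proof.
wlog xy : x y / x <= y.
  move=> H; have [/H//|/ltW/H] := leP x y.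
  by rewrite distrC [leRHS]distrC.
have [c _ e] := @MVT_closed R sin cos x y xy (fun z _ => is_derive_sin z).
rewrite distrC e normrM [leRHS]distrC ler_piMl// ler_norml.
by rewrite cos_geN1 cos_le1.
Qed.

Section ParallelPart.
Variables (R : realType) (d : nat) (w : 'rV[R]_d).
Hypothesis w1 : sphere w.
Implicit Types (u z theta : 'rV[R]_d).

Lemma dot_par_part_axis u : dot (par_part w u) w = 0.
Proof. by rewrite dotBl dotZl (dot_sphere w1) mulr1 subrr. Qed.

Lemma dot_par_part u z : dot z w = 0 -> dot (par_part w u) z = dot u z.
Proof. by move=> zw; rewrite dotBl dotZl (dotC w) zw mulr0 subr0. Qed.

Lemma sqr_enorm_par_part theta : sphere theta ->
  enorm (par_part w theta) ^+ 2 = 1 - dot theta w ^+ 2.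
Proof.
move=> th1; rewrite sqr_enorm dot_par_part ?dot_par_part_axis//.
by rewrite dotBr dotZr (dot_sphere th1) expr2.
Qed.

End ParallelPart.

(** * The shift and the expansion of the phase *)

Section Shift.
Variables (R : realType) (d : nat) (kappa alpha delta : R) (k w : 'rV[R]_d).
Hypotheses (w1 : sphere w) (kappa_gt0 : 0 < kappa).
Hypotheses (alpha_lt0 : alpha < 0) (delta01 : 0 < delta < 1).

(** The formula is a root of the quadratic equation in rationalized form; the discriminant is
    positive because [alpha < 0]. The last bound follows from [A * beta <= 0]. *)
Lemma beta_quadratic (A q beta : R) : 0 <= A -> 0 < q ->
  beta = 2 * alpha / (A + Num.sqrt (A ^+ 2 - 4 * q * alpha)) ->
  [/\ beta < 0, A * beta - q * beta ^+ 2 = alpha & beta ^+ 2 <= - alpha / q].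
Proof.
move=> A0 q0.
have p0 : 0 < - 4 * q * alpha by rewrite mulNr mulNr oppr_gt0 nmulr_llt0 ?mulr_gt0.
have disc0 : 0 < A ^+ 2 - 4 * q * alpha.
  by rewrite ltr_wpDl ?sqr_ge0// -mulNr -mulNr.
have := sqr_sqrtr (ltW disc0); have : 0 < Num.sqrt (A ^+ 2 - 4 * q * alpha).
  by rewrite sqrtr_gt0.
set s := Num.sqrt _ => s0 s2 betaE.
have As0 : 0 < A + s by rewrite ltr_wpDl.
have bE : beta * (A + s) = 2 * alpha by rewrite betaE divfK// gt_eqF.
have b0 : beta < 0 by rewrite betaE nmulr_rlt0 ?invr_gt0// pmulr_rlt0.
have quad : A * beta - q * beta ^+ 2 = alpha.
  have a0 : alpha != 0 by rewrite lt_eqF.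
  (* Multiplying by [4 * alpha] allows both the square root and [alpha] to be eliminated through
     [s2] and [bE]. *)
  have : 4 * alpha * (A * beta - q * beta ^+ 2 - alpha) = 0.
    have -> : 4 * alpha * (A * beta - q * beta ^+ 2 - alpha) =
      4 * alpha * (A * beta) + (A ^+ 2 - 4 * q * alpha - A ^+ 2) * beta ^+ 2 -
      (2 * alpha) ^+ 2.
      by ring.
    rewrite -s2 -bE.
    have -> : 4 * alpha = 2 * (2 * alpha) by ring.
    by rewrite -bE; ring.
  by move/eqP; rewrite !mulf_eq0 (negbTE a0) pnatr_eq0 /= subr_eq0 => /eqP.
split=> //; rewrite ler_pdivlMr// mulrC.
by have : A * beta <= 0; [rewrite mulr_ge0_le0// ltW|move: quad; lra].
Qed.

(** Both cases of the choice of shift give [zeta] equal to [beta *: zetah] up to sign, with [zetah]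
    a unit vector. The bound on [beta ^+ 2] is uniform because
    [|t| <= enorm (par_part w theta) < delta]. *)
Lemma shift_identities r theta zeta zetah beta : 0 < r -> sphere theta ->
  enorm (par_part w theta) < delta ->
  shift_choice kappa k w alpha r theta zeta zetah beta ->
  let A := enorm (par_part w k - kappa *: par_part w theta) in
  let t := dot (par_part w theta) zetah in
  [/\ enorm zeta = `|beta|, dot theta zeta ^+ 2 = beta ^+ 2 * t ^+ 2,
     dot k zeta - kappa * dot theta zeta = A * beta,
     A * beta - kappa * (1 - t ^+ 2) / (2 * r) * beta ^+ 2 = alpha &
     beta ^+ 2 <= 2 * - alpha / (kappa * (1 - delta ^+ 2)) * r].
Proof.
move=> r0 th1 thd [zne zeq betaE] A t.
pose v := kappa *: par_part w theta - par_part w k.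
have vw : dot v w = 0 by rewrite dotBl dotZl !dot_par_part_axis// mulr0 subr0.
have AE : enorm v = A by rewrite /A -enormN opprB.
have zw : dot zetah w = 0.
  have [/zeq[]//|/eqP/zne[_ ->]] := eqVneq (kappa *: par_part w theta) (par_part w k).
  by rewrite dotZl /direction dotZl vw !mulr0.
(* Only an inequality so far: the sign of [beta] is determined below, after this bound has made [q]
   positive. *)
have zn : enorm zetah <= 1.
  have [/zeq[_ _ ->]//|/eqP ne] := eqVneq (kappa *: par_part w theta) (par_part w k).
  have v0 : v != 0 by rewrite subr_eq0; exact/eqP.
  have [_ ->] := zne ne; rewrite enormZ (enorm_direction v0) mulr1 normrN normr_sg.
  by case: (_ != 0).
have [d0 d1] := andP delta01.
have td : `|t| <= delta.
  rewrite (le_trans (ler_dot_enorm _ _))// -[delta]mulr1 ler_pM ?enorm_ge0//.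
  exact: ltW.
have t2 : t ^+ 2 <= delta ^+ 2.
  by rewrite -real_normK ?num_real// ler_pXn2r// nnegrE// ltW.
have d2 : delta ^+ 2 < 1 by rewrite expr_lt1// ltW.
pose q := kappa * (1 - t ^+ 2) / (2 * r).
have t1 : 0 < 1 - t ^+ 2 by rewrite subr_gt0 (le_lt_trans t2).
have q0 : 0 < q by rewrite divr_gt0 ?mulr_gt0.
have [|||b0 quad b2] := @beta_quadratic A q beta.
- exact: enorm_ge0.
- exact: q0.
- rewrite betaE -/A -/t; congr (_ / (_ + Num.sqrt (_ + _))).
  by rewrite /q; field; rewrite gt_eqF.
(* The sign [e] is 1 when the two parallel parts agree and -1 otherwise, since then the negative
   sign of [beta] makes [zetah] the direction of [v]. *)
have zE : exists2 e : R, e ^+ 2 = 1 & zeta = (e * beta) *: zetah /\ enorm zetah = 1 /\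
    dot k zeta - kappa * dot theta zeta = A * beta.
  have kz u : dot u w = 0 -> dot k u - kappa * dot theta u = - dot v u.
    by move=> uw; rewrite dotBl dotZl !dot_par_part// opprB.
  have [e|/eqP ne] := eqVneq (kappa *: par_part w theta) (par_part w k).
    have [-> _ z1] := zeq e; exists 1; first by rewrite expr1n.
    rewrite mul1r; split=> //; split=> //.
    have v0 : v = 0 by rewrite /v e subrr.
    by rewrite kz ?dotZl ?zw ?mulr0// -AE v0 dot0l /enorm dot0l sqrtr0 mul0r oppr0.
  have v0 : v != 0 by rewrite subr_eq0; exact/eqP.
  have [zetaE zetahE] := zne ne.
  have zh : zetah = direction v by rewrite zetahE ltr0_sg// opprK scale1r.
  exists (-1); first by rewrite sqrrN expr1n.
  rewrite mulN1r zh; split=> //; split; first exact: enorm_direction.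
  rewrite kz; last by rewrite zetaE dotZl -/v -zh zw mulr0.
  rewrite zetaE -/v dotZr dotZr -sqr_enorm AE.
  by field; rewrite -AE gt_eqF// enorm_gt0.
have [e e2 [zetaE [z1 kz]]] := zE.
have eN : `|e| = 1.
  by apply/eqP; rewrite -[_ == 1](@eqrXn2 _ 2)// real_normK ?num_real// e2 expr1n.
split=> //.
- by rewrite zetaE enormZ z1 mulr1 normrM eN mul1r.
- by rewrite zetaE dotZr -(dot_par_part theta zw) -/t !exprMn e2 mul1r.
- apply: (le_trans b2); rewrite /q.
  rewrite [leLHS](_ : _ = 2 * - alpha * r / (kappa * (1 - t ^+ 2))); last first.
    by field; rewrite !gt_eqF.
  have c0 : 0 <= 2 * - alpha * r by rewrite ltW// !mulr_gt0// oppr_gt0.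
  rewrite [leRHS]mulrAC ler_wpM2l//.
  have dt : 1 - delta ^+ 2 <= 1 - t ^+ 2 by rewrite lerB.
  have dd : 0 < 1 - delta ^+ 2 by rewrite subr_gt0.
  by rewrite lef_pV2 ?posrE ?ler_pM2l// mulr_gt0.
Qed.


(* |y| - |x| - (theta, zeta) differs from (|zeta|^2 - (theta, zeta)^2) / (2 r)
   by O(|beta|^3 / r^2), and |beta| = O(r^(1/2)). *)
Lemma norm_shift_expansion (r n S b : R) : 0 < r -> 0 <= b -> 2 * b <= r ->
  `|S| <= b -> 0 <= n -> n ^+ 2 = r ^+ 2 + 2 * r * S + b ^+ 2 ->
  [/\ r / 2 <= n, `|r - n| <= b &
    `|n - r - S - (b ^+ 2 - S ^+ 2) / (2 * r)| <= b ^+ 3 / r ^+ 2].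
Proof.
move=> r0 b0 br Sb n0 nE; move: (Sb); rewrite ler_norml => /andP[S1 S2].
have S22 : S ^+ 2 <= b ^+ 2.
  by rewrite -real_normK ?num_real// ler_pXn2r// nnegrE.
have n1 : r - b <= n.
  rewrite -(@ler_pXn2r _ 2)// ?nnegrE//; last lra.
  have : 0 <= r * (S + b) by rewrite mulr_ge0 ?(ltW r0)//; lra.
  rewrite nE; lra.
have n2 : n <= r + b.
  rewrite -(@ler_pXn2r _ 2)// ?nnegrE//; last lra.
  have : 0 <= r * (b - S) by rewrite mulr_ge0 ?(ltW r0)//; lra.
  rewrite nE; lra.
split; [lra|by rewrite ler_norml; lra|].
have D0 : r <= n + r + S by lra.
have D1 : 0 < n + r + S by lra.
(* From [n ^+ 2 - (r + S) ^+ 2 = b ^+ 2 - S ^+ 2] one divides by [n + r + S]; comparing that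
   denominator with [2 * r] leaves the extra factor [r - n - S], of size at most [2 * b]. *)
have E : n - r - S - (b ^+ 2 - S ^+ 2) / (2 * r) =
    (b ^+ 2 - S ^+ 2) * (r - n - S) / (2 * r * (n + r + S)).
  have h : n - r - S = (b ^+ 2 - S ^+ 2) / (n + r + S).
    apply/eqP; rewrite eq_sym -subr_eq0 -(mulfK (lt0r_neq0 D1) (n - r - S)).
    rewrite -mulrBl mulf_eq0; apply/orP; left; apply/eqP.
    have -> : (n - r - S) * (n + r + S) = n ^+ 2 - (r + S) ^+ 2 by ring.
    by rewrite nE; ring.
  by rewrite h; field; rewrite !gt_eqF.
rewrite E normrM normrV ?unitfE ?mulf_neq0 ?(lt0r_neq0 D1) ?(lt0r_neq0 r0)//.
have D2 : 0 < 2 * r * (n + r + S) by rewrite !mulr_gt0.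
rewrite (gtr0_norm D2) ler_pdivrMr//.
have h1 : `|(b ^+ 2 - S ^+ 2) * (r - n - S)| <= b ^+ 2 * (2 * b).
  rewrite normrM ler_pM//.
    by rewrite ger0_norm ?subr_ge0// gerBl sqr_ge0.
  by rewrite ler_norml; lra.
apply: (le_trans h1).
rewrite (_ : b ^+ 2 * (2 * b) = b ^+ 3 / r ^+ 2 * (2 * r * r)); last first.
  by field; rewrite gt_eqF.
rewrite ler_wpM2l ?divr_ge0 ?exprn_ge0 ?(ltW r0)//.
by rewrite ler_wpM2l// mulr_ge0// ltW.
Qed.

(** The quadratic equation for [beta] cancels the second-order term of [kappa * enorm y]; what
    remains is of order |beta|^3 / r^2, hence r^(-1/2) since |beta| = O(r^(1/2)). *)
Lemma shift_asymptotics : exists L r1 : R, 0 <= L /\ 0 < r1 /\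
  forall theta r zeta zetah beta, sphere theta ->
    enorm (par_part w theta) < delta -> r1 <= r ->
    shift_choice kappa k w alpha r theta zeta zetah beta ->
    let y := r *: theta + zeta in
    [/\ r / 2 <= enorm y, enorm (direction y - theta) <= L / Num.sqrt r &
      `|dot k zeta + kappa * r - kappa * enorm y - alpha| <= L / Num.sqrt r].
Proof.
have [d0 d1] := andP delta01.
have d2 : delta ^+ 2 < 1 by rewrite expr_lt1// ltW.
have q0 : 0 < 2 * - alpha / (kappa * (1 - delta ^+ 2)).
  by rewrite divr_gt0 ?mulr_gt0 ?oppr_gt0 ?subr_gt0.
pose L0 := Num.sqrt (2 * - alpha / (kappa * (1 - delta ^+ 2))).
have L00 : 0 < L0 by rewrite sqrtr_gt0.
have L02 : L0 ^+ 2 = 2 * - alpha / (kappa * (1 - delta ^+ 2)).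
  by rewrite sqr_sqrtr// ltW.
(* [4 * L0] serves the directions and [kappa * L0 ^+ 3] the phase; the threshold [4 * L0 ^+ 2]
   ensures [2 * b <= r]. *)
exists (4 * L0 + kappa * L0 ^+ 3), (4 * L0 ^+ 2); split; last split.
- by rewrite addr_ge0// mulr_ge0 ?exprn_ge0// ltW.
- by rewrite mulr_gt0// exprn_gt0.
move=> theta r zeta zetah beta th1 thd rr1 sc y.
have r0 : 0 < r by apply: lt_le_trans rr1; rewrite mulr_gt0// exprn_gt0.
have [zn S2 kz quad b2] := shift_identities r0 th1 thd sc.
move: S2 kz quad; set A := enorm _; set t := dot (par_part _ _) _ => S2 kz quad.
set S := dot theta zeta in S2 kz; pose b := `|beta|.
set s := Num.sqrt r.
have s0 : 0 < s by rewrite sqrtr_gt0.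
have s2 : s ^+ 2 = r by rewrite sqr_sqrtr// ltW.
have bs : b <= L0 * s.
  rewrite -(@ler_pXn2r _ 2)// ?nnegrE ?normr_ge0 ?mulr_ge0 ?(ltW L00) ?(ltW s0)//.
  by rewrite exprMn s2 L02 /b real_normK ?num_real.
have sL : 2 * L0 <= s.
  rewrite -(@ler_pXn2r _ 2)// ?nnegrE ?mulr_ge0 ?(ltW L00) ?(ltW s0)//.
  by rewrite s2 exprMn -natrX.
have br : 2 * b <= r.
  rewrite -[leRHS]s2 expr2 (@le_trans _ _ (2 * L0 * s))//.
    by rewrite -mulrA ler_wpM2l.
  by rewrite ler_wpM2r// ltW.
have Sb : `|S| <= b.
  by rewrite (le_trans (ler_dot_enorm _ _))// [enorm theta]th1 mul1r zn.
have yE : enorm y ^+ 2 = r ^+ 2 + 2 * r * S + b ^+ 2.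
  rewrite sqr_enorm /y dotDl !dotDr !dotZl !dotZr (dot_sphere th1) -(sqr_enorm zeta) zn.
  by rewrite (dotC zeta) -/S -/b; ring.
have [y1 y2 y3] := norm_shift_expansion r0 (normr_ge0 beta) br Sb (enorm_ge0 y) yE.
have y0 : 0 < enorm y by apply: lt_le_trans y1; rewrite divr_gt0.
have cube : b ^+ 3 / r ^+ 2 <= L0 ^+ 3 / s.
  rewrite ler_pdivrMr ?exprn_gt0//.
  rewrite (_ : _ * r ^+ 2 = (L0 * s) ^+ 3); last first.
    by rewrite -[in LHS]s2; field; rewrite gt_eqF.
  by rewrite ler_pXn2r// nnegrE ?normr_ge0 ?mulr_ge0 ?(ltW L00) ?(ltW s0).
have p1 : 0 <= 4 * L0 / s by rewrite divr_ge0 ?mulr_ge0 ?ltW.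
have p2 : 0 <= kappa * L0 ^+ 3 / s.
  by rewrite divr_ge0 ?mulr_ge0 ?exprn_ge0 ?ltW.
split=> //.
- have -> : direction y - theta = (enorm y)^-1 *: ((r - enorm y) *: theta + zeta).
    rewrite scalerDl scaleNr addrAC -/y scalerBr scalerA mulVf ?gt_eqF// scale1r.
    by [].
  rewrite enormZ ger0_norm ?invr_ge0 ?enorm_ge0// mulrC ler_pdivrMr//.
  rewrite (le_trans (ler_enormD _ _))// enormZ [enorm theta]th1 mulr1 zn -/b.
  apply: (@le_trans _ _ (2 * (L0 * s))).
    by move: y2 bs; rewrite -/b; lra.
  apply: (@le_trans _ _ (4 * L0 / s * (r / 2))).
    rewrite -[in X in _ <= X]s2 le_eqVlt; apply/orP; left; apply/eqP.
    by field; rewrite gt_eqF.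
  apply: (@le_trans _ _ (4 * L0 / s * enorm y)); first by rewrite ler_wpM2l.
  by rewrite ler_wpM2r ?enorm_ge0// mulrDl; lra.
- have -> : dot k zeta + kappa * r - kappa * enorm y - alpha =
    - (kappa * (enorm y - r - S - (b ^+ 2 - S ^+ 2) / (2 * r))).
    have bb : b ^+ 2 = beta ^+ 2 by rewrite real_normK// num_real.
    have -> : dot k zeta = A * beta + kappa * S by rewrite -kz subrK.
    rewrite S2 bb -{1}quad; field; rewrite gt_eqF//.
  rewrite normrN normrM gtr0_norm// [leRHS]mulrDl.
  have := ler_wpM2l (ltW kappa_gt0) (le_trans y3 cube); rewrite mulrA -/b; lra.
Qed.

End Shift.

(** * Complex amplitudes *)


Section ComplexFacts.
Local Open Scope complex_scope.
Variable R : realType.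
Implicit Types (s t : R) (z w : R[i]).

Lemma cisD s t : cis (s + t) = cis s * cis t.
Proof.
rewrite /cis cosD sinD; apply/eqP; rewrite eq_complex /=.
by apply/andP; split; apply/eqP; ring.
Qed.

Lemma cisK t : cis (- t) * cis t = 1.
Proof. by rewrite -cisD addNr /cis cos0 sin0. Qed.

Lemma norm_cis t : `|cis t| = 1.
Proof. by rewrite normc_def /= cos2Dsin2 sqrtr1. Qed.

Lemma conjc_cis t : (cis t)^*%C = cis (- t).
Proof. by rewrite /cis /= cosN sinN. Qed.

Lemma conjcD z w : (z + w)^*%C = z^*%C + w^*%C.
Proof. exact: rmorphD. Qed.

Lemma conjcM z w : (z * w)^*%C = z^*%C * w^*%C.
Proof. exact: rmorphM. Qed.

Lemma cisB t : cis t - cis (- t) = 2 * 'i%C * (sin t)%:C.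
Proof.
rewrite /cis cosN sinN; apply/eqP; rewrite eq_complex /=.
by apply/andP; split; apply/eqP; ring.
Qed.

Lemma norm_real_complex t : `|t%:C| = `|t|%:C.
Proof. by rewrite normc_def /= expr0n addr0 sqrtr_sqr. Qed.

Lemma norm_2i t : `|2 * 'i%C * t%:C| = (2 * `|t|)%:C :> R[i].
Proof.
rewrite -mulrA normrM [`|'i%C * _|]normrM norm_real_complex [`|'i%C|]normc_def /=.
by rewrite expr0n expr1n add0r sqrtr1 mul1r rmorphM normr_nat rmorph_nat.
Qed.

Lemma complex_norm_le z t : `|z| <= t%:C ->
  `|complex.Re z| <= t /\ `|complex.Im z| <= t.
Proof.
rewrite normc_def lecR.
have r0 := sqr_ge0 (complex.Re z); have i0 := sqr_ge0 (complex.Im z).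
by move=> h; split; apply: le_trans h; rewrite -[leLHS]sqrtr_sqr ler_wsqrtr ?lerDl ?lerDr.
Qed.

Lemma le_complex_norm z s t : `|complex.Re z| <= s -> `|complex.Im z| <= t ->
  `|z| <= (s + t)%:C.
Proof.
move=> rs it; rewrite (complexE z) (le_trans (ler_normD _ _))// rmorphD lerD//.
  by rewrite norm_real_complex lecR.
by rewrite normrM norm_real_complex normc_def /= expr0n expr1n add0r sqrtr1 mul1r lecR.
Qed.

End ComplexFacts.

Section ExteriorDomain.
Variables (R : realType) (d : nat) (Omega : set 'rV[R]_d).

Lemma exteriorE : open Omega -> exterior Omega = ~` closure Omega.
Proof.
move=> /interior_id oO; rewrite /exterior /boundary oO; congr (~` _).
apply/seteqP; split=> [x [Ox|[]//]|x cx]; first exact: subset_closure.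
by have [|] := pselect (Omega x); [left|right].
Qed.

Lemma open_exterior : open Omega -> open (exterior Omega).
Proof. by move=> oO; rewrite exteriorE// openC; exact: closed_closure. Qed.

Lemma exterior_outside_ball : open Omega -> bounded_set Omega ->
  exists2 r0 : R, 0 < r0 & forall x, r0 <= enorm x -> exterior Omega x.
Proof.
move=> oO /ex_strict_bound_gt0[M M0 OM]; exists (d%:R * M + 1).
  by rewrite ltr_wpDl// mulr_ge0// ltW.
move=> x xM; rewrite exteriorE//= => cx.
have : closure Omega `<=` [set y : 'rV[R]_d | `|y| <= M].
  rewrite closureE; apply: smallest_sub => [|y /OM/ltW//].
  apply: (@closed_comp 'rV[R]_d R (fun y => `|y|) [set t : R | t <= M]).
    by move=> y _; apply: (@norm_continuous _ 'rV[R]_d).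
  exact: closed_le.
move=> /(_ x cx) /= xM'; have := ler_enorm_norm x.
by have := ler_wpM2l (ler0n R d) xM'; lra.
Qed.

End ExteriorDomain.

(** * From the complex solution to a pair of real waves *)

Section FarField.
Local Open Scope complex_scope.
Variables (R : realType) (d : nat) (Omega : set 'rV[R]_d) (kappa : R).
Variables (psi f : 'rV[R]_d -> R[i]).
Local Notation dec := (decay R d).

Definition amplitude (x : 'rV[R]_d) : R[i] := (enorm x `^ dec)%:C * psi x.

(** Multiplying by |x|^decay turns the error exponent - (d + 1) / 2 into -1. *)
Lemma far_field_amplitude : open Omega -> bounded_set Omega ->
  far_field_pattern (exterior Omega) kappa psi f ->
  exists C R0 : R, [/\ 0 <= C, 1 <= R0,
    forall x, R0 <= enorm x -> exterior Omega x &
    forall x, R0 <= enorm x ->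
      `|amplitude x - cis (kappa * enorm x) * f (direction x)| <= (C / enorm x)%:C].
Proof.
move=> oO bO [c [r0 [r00 far]]].
have [r1 r10 out] := exterior_outside_ball oO bO.
exists `|c|, (Num.max 1 (Num.max r0 r1)); split=> [//||x|x].
- by rewrite le_max lexx.
- by rewrite !ge_max => /and3P[_ _ /out].
rewrite !ge_max => /and3P[x1 xr0 /out Ux].
have x0 : 0 < enorm x := lt_le_trans ltr01 x1.
have w0 : 0 < enorm x `^ dec by exact: powR_gt0.
have wC : (enorm x `^ dec)%:C != 0 :> R[i].
  by rewrite -(rmorph0 (real_complex R)) (inj_eq (@complexI R)) gt_eqF.
have -> : amplitude x - cis (kappa * enorm x) * f (direction x) =
    (enorm x `^ dec)%:C *
    (psi x - cis (kappa * enorm x) / (enorm x `^ dec)%:C * f (direction x)).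
  by rewrite /amplitude; field.
rewrite normrM norm_real_complex (gtr0_norm w0).
apply: (@le_trans _ _ ((enorm x `^ dec)%:C * (c * enorm x `^ (- ((d%:R + 1) / 2)))%:C)).
  by rewrite ler_wpM2l ?ler0c ?(ltW w0)//; exact: far.
rewrite -rmorphM lecR mulrCA -powRD; last by rewrite (gt_eqF x0) implybT.
rewrite (_ : dec + _ = - 1); last by rewrite /decay; field.
by rewrite powR_inv1 ?(ltW x0)// ler_wpM2r ?invr_ge0 ?(ltW x0)// ler_norm.
Qed.

Lemma wave_amplitude x :
  cis (- (kappa * enorm x)) * amplitude x =
  wave kappa (fun y => complex.Re (psi y)) (fun y => complex.Im (psi y)) x +i*
  wave kappa (fun y => complex.Im (psi y)) (fun y => - 1 * complex.Re (psi y)) x.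
Proof.
rewrite /amplitude /wave /cis; case: (psi x) => u v /=.
apply/eqP; rewrite eq_complex /= cosN sinN.
by apply/andP; split; apply/eqP; ring.
Qed.

(** The real lemma is applied to the real part of [f], then to its imaginary part with the two
    components exchanged and [kappa] replaced by [- kappa]. *)
Lemma far_field_regular : (2 <= d)%N -> open Omega -> bounded_set Omega ->
  class_Cc 2 (exterior Omega) psi ->
  (forall x, exterior Omega x -> - laplacian psi x = (kappa ^+ 2)%:C * psi x) ->
  far_field_pattern (exterior Omega) kappa psi f ->
  exists2 K : R, 0 <= K & forall x y, sphere x -> sphere y ->
    `|f x - f y| <= (K * enorm (x - y))%:C.
Proof.
move=> d2 oO bO [aC bC] eqn far.
have [C [R0 [C0 R01 out amp]]] := far_field_amplitude oO bO far.
have R00 : 0 < R0 := lt_le_trans ltr01 R01.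
pose a y := complex.Re (psi y); pose b y := complex.Im (psi y).
pose fu y := complex.Re (f y); pose fv y := complex.Im (f y).
have parts x : exterior Omega x -> real_laplacian a x = - kappa ^+ 2 * a x /\
    real_laplacian b x = - kappa ^+ 2 * b x.
  move=> /eqn; rewrite /laplacian => e.
  have sumE (g h : 'I_d -> R) : \sum_i (g i +i* h i) = (\sum_i g i) +i* (\sum_i h i).
    apply/eqP; rewrite eq_complex /=; apply/andP; split; apply/eqP.
      by elim/big_rec2: _ => // i _ [u v] _ <-.
    by elim/big_rec2: _ => // i _ [u v] _ <-.
  move: e; rewrite /partialc {1}/derivec sumE /a /b.
  rewrite -[X in X +i* _]/(real_laplacian a x) -[X in _ +i* X]/(real_laplacian b x).
  case: (psi x) => u v /eqP; rewrite eq_complex /= !mul0r subr0 addr0.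
  by move=> /andP[/eqP e1 /eqP e2]; split; rewrite mulNr -?e1 -?e2 opprK.
have waves r th : R0 <= r -> sphere th ->
    `|wave kappa a b (r *: th) - fu th| <= C / r /\
    `|wave kappa b (fun y => - 1 * a y) (r *: th) - fv th| <= C / r.
  move=> rR0 th1; have r0 := lt_le_trans R00 rR0.
  have er : enorm (r *: th) = r by rewrite enormZ_sphere// ltW.
  have := amp (r *: th); rewrite er direction_ray// => /(_ rR0) h.
  apply: (complex_norm_le (z := (wave kappa a b (r *: th) - fu th) +i*
    (wave kappa b (fun y => - 1 * a y) (r *: th) - fv th))).
  (* A unimodular factor moves the phase from the limit [f] to the amplitude, whose components are
     then the two waves. *)
  apply: le_trans h; rewrite -[leRHS]mul1r -(norm_cis (- (kappa * r))) -normrM mulrBr.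
  rewrite (mulrA (cis (- (kappa * r))) (cis (kappa * r))) cisK mul1r.
  have := wave_amplitude (r *: th); rewrite er => ->.
  rewrite le_eqVlt; apply/orP; left; apply/eqP.
  by congr (`|_|); rewrite /fu /fv; case: (f th).
have V_open := open_exterior oO.
(* Exchanging the parts and the sign of kappa exchanges the two waves. *)
have flip c u v x : wave c u (fun y => - 1 * v y) x = wave (- c) u v x.
  by rewrite /wave !mulNr cosN sinN; ring.
have [K1 K10 lip1] := far_field_lipschitz d2 R00 V_open out aC bC
  (fun x Ux => (parts x Ux).1) (fun x Ux => (parts x Ux).2)
  (fun r th rR0 th1 => (waves r th rR0 th1).1) (fun r th rR0 th1 => (waves r th rR0 th1).2).
have [|||| K2 K20 lip2] :=
  @far_field_lipschitz R d (- kappa) R0 C (exterior Omega) b a fv fu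
  d2 R00 V_open out bC aC.
- by move=> x Ux; rewrite sqrrN; have [] := parts x Ux.
- by move=> x Ux; rewrite sqrrN; have [] := parts x Ux.
- by move=> r th rR0 th1; rewrite -flip; have [] := waves r th rR0 th1.
- move=> r th rR0 th1; rewrite flip opprK.
  by have [] := waves r th rR0 th1.
exists (K1 + K2); first exact: addr_ge0.
have sym (g : 'rV[R]_d -> R) K : (forall x y, sphere x -> sphere y ->
    g x - g y <= K * enorm (x - y)) ->
    forall x y, sphere x -> sphere y -> `|g x - g y| <= K * enorm (x - y).
  move=> gl x y x1 y1; rewrite ler_norml gl// andbT lerNl opprB.
  by rewrite -enormN opprB gl.
move=> x y x1 y1; rewrite mulrDl; apply: le_complex_norm.
  by rewrite [complex.Re _](_ : _ = fu x - fu y) ?sym// /fu; case: (f x) (f y) => ? ? [].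
by rewrite [complex.Im _](_ : _ = fv x - fv y) ?sym// /fv; case: (f x) (f y) => ? ? [].
Qed.

End FarField.


(** * The intensity as a linear expression in the far field and its conjugate *)

Section Intensity.
Local Open Scope complex_scope.
Variables (R : realType) (d : nat) (psi : 'rV[R]_d -> R[i]) (k : 'rV[R]_d).
Implicit Types (x : 'rV[R]_d) (g : R[i]).
Local Notation dec := (decay R d).

Definition phase x : R := dot k x - enorm k * enorm x.

Lemma intensityE x : x != 0 ->
  intensity psi k x = cis (dot k x) * (amplitude psi x)^*%C +
    cis (- dot k x) * amplitude psi x +
    ((enorm x `^ dec)^-1)%:C * (amplitude psi x * (amplitude psi x)^*%C).
Proof.
move=> /enorm_gt0 x0; have w0 : 0 < enorm x `^ dec by exact: powR_gt0.
rewrite /intensity /amplitude -/(decay R d) /plane_wave sqr_normc.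
rewrite conjcD [in RHS]conjcM conjc_cis conjc_real.
set w := enorm x `^ dec in w0 *; set e := cis (dot k x).
have ee : e * cis (- dot k x) = 1 by rewrite mulrC cisK.
have ww : (w^-1)%:C * w%:C = 1 :> R[i] by rewrite -rmorphM mulVf ?gt_eqF.
transitivity (w%:C * ((e * cis (- dot k x) - 1) + e * (psi x)^*%C +
  cis (- dot k x) * psi x + psi x * (psi x)^*%C)); first by ring.
rewrite ee subrr add0r.
rewrite [in RHS](_ : (w^-1)%:C * _ = ((w^-1)%:C * w%:C) * (w%:C * (psi x * (psi x)^*%C))).
  by rewrite ww; ring.
by ring.
Qed.

(** Replacing the amplitude by its leading term costs O(1/|x|) in the linear part. The quadratic
    part is of size |x|^(- decay), at most |x|^(-1/2) as [d >= 2]; it sets the final rate. *)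
Lemma intensity_expansion x g (C M : R) :
  (2 <= d)%N -> 1 <= enorm x -> 0 <= C -> 0 <= M ->
  `|g| <= M%:C ->
  `|amplitude psi x - cis (enorm k * enorm x) * g| <= (C / enorm x)%:C ->
  `|intensity psi k x - (cis (- phase x) * g + cis (phase x) * g^*%C)| <=
  ((2 * C + (M + C) ^+ 2) / Num.sqrt (enorm x))%:C.
Proof.
move=> d2 x1 C0 M0 gM; have x0 : 0 < enorm x := lt_le_trans ltr01 x1.
have xn0 : x != 0.
  by apply: contraTneq x0 => ->; rewrite /enorm dot0l sqrtr0 ltxx.
set A := amplitude psi x; set E := A - _ => EC.
have AE : A = cis (enorm k * enorm x) * g + E by rewrite /E addrC subrK.
have s0 : 0 < Num.sqrt (enorm x) by rewrite sqrtr_gt0.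
have s1 : 1 <= Num.sqrt (enorm x) by rewrite -sqrtr1 ler_wsqrtr.
have s2 : Num.sqrt (enorm x) ^+ 2 = enorm x by rewrite sqr_sqrtr// ltW.
have EC' : `|E| <= (C / Num.sqrt (enorm x))%:C.
  apply: (le_trans EC); rewrite lecR ler_wpM2l// lef_pV2// -[leRHS]s2 expr2.
  by rewrite ler_peMr// ltW.
have Cs : C / Num.sqrt (enorm x) <= C.
  by rewrite ler_pdivrMr// ler_peMr.
have AM : `|A| <= (M + C)%:C.
  rewrite AE (le_trans (ler_normD _ _))// (rmorphD (real_complex R)) lerD//.
    by rewrite normrM norm_cis mul1r.
  by rewrite (le_trans EC')// lecR.
have dec_ge : Num.sqrt (enorm x) <= enorm x `^ dec.
  rewrite -powR12_sqrt ?(ltW x0)// ler_powR// /decay.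
  by have : (2 : R) <= d%:R; [rewrite ler_nat|lra].
rewrite intensityE// -/A.
have -> : cis (dot k x) * A^*%C + cis (- dot k x) * A +
    ((enorm x `^ dec)^-1)%:C * (A * A^*%C) -
    (cis (- phase x) * g + cis (phase x) * g^*%C) =
  cis (dot k x) * E^*%C + cis (- dot k x) * E + ((enorm x `^ dec)^-1)%:C * (A * A^*%C).
  have p1 : cis (phase x) = cis (dot k x) * cis (- (enorm k * enorm x)) by rewrite -cisD.
  have p2 : cis (- phase x) = cis (- dot k x) * cis (enorm k * enorm x).
    by rewrite -cisD opprB addrC.
  rewrite p1 p2 {1 2}AE conjcD conjcM conjc_cis; ring.
rewrite (le_trans (ler_normD _ _))// (mulrDl (2 * C)).
rewrite (rmorphD (real_complex R)) lerD//.
  rewrite (le_trans (ler_normD _ _))// !normrM !norm_cis !mul1r normcJ.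
  have -> : 2 * C / Num.sqrt (enorm x) = C / Num.sqrt (enorm x) + C / Num.sqrt (enorm x).
    by rewrite -mulrA mulr_natl mulr2n.
  by rewrite (rmorphD (real_complex R)) lerD.
have v0 : 0 <= (enorm x `^ dec)^-1 by rewrite invr_ge0 powR_ge0.
rewrite (normrM (_^-1)%:C) (normrM A) normcJ norm_real_complex (ger0_norm v0).
rewrite mulrC (rmorphM (real_complex R)); apply: ler_pM => //.
- by rewrite ler0c.
- by rewrite (rmorphXn (real_complex R)) expr2 ler_pM.
- by rewrite lecR lef_pV2// posrE powR_gt0.
Qed.

End Intensity.

Section TwoPoints.
Local Open Scope complex_scope.
Variables (R : realType) (d : nat) (psi : 'rV[R]_d -> R[i]) (k : 'rV[R]_d).

(** Cramer's rule: this combination of the intensities at the two points eliminates the conjugate of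
    [f], and the coefficient left on [f] is the determinant. The identity is exact, so only the two
    expansion errors remain to be bounded. *)
Lemma f11_solves x zeta (f : R[i]) : two_point_det k x zeta != 0 ->
  f11 psi k x zeta - f = (two_point_det k x zeta)^-1 *
    (cis (phase k (x + zeta)) *
       (intensity psi k x - (cis (- phase k x) * f + cis (phase k x) * f^*%C)) -
     cis (phase k x) * (intensity psi k (x + zeta) -
       (cis (- phase k (x + zeta)) * f + cis (phase k (x + zeta)) * f^*%C))).
Proof.
set y := x + zeta; set D := two_point_det k x zeta => D0.
have DE : D = cis (phase k y) * cis (- phase k x) - cis (phase k x) * cis (- phase k y).
  rewrite -!cisD /D /two_point_det -/y.
  have -> : phase k x - phase k y = - (phase k y - phase k x) by ring.
  have -> : dot k zeta + enorm k * enorm x - enorm k * enorm y = phase k y - phase k x.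
    by rewrite /phase /y dotDr; ring.
  by rewrite -cisB.
rewrite /f11 -/y -/D -!/(phase k _).
apply: (mulfI D0); rewrite mulrBr !(mulrA D) mulfV// !mul1r {1}DE; ring.
Qed.

End TwoPoints.


(** * The two-point estimate *)

Section Estimate.
Local Open Scope complex_scope.

Lemma f11_estimate_uniform (R : realType) (d : nat) (Omega : set 'rV[R]_d)
    (w k : 'rV[R]_d) (kappa alpha delta : R) (psi f : 'rV[R]_d -> R[i]) :
  (2 <= d)%N -> open Omega -> bounded_set Omega -> sphere w -> enorm k = kappa ->
  0 < kappa -> alpha < 0 -> sin alpha <> 0 -> class_Cc 2 (exterior Omega) psi ->
  (forall x, exterior Omega x -> - laplacian psi x = (kappa ^+ 2)%:C * psi x) ->
  far_field_pattern (exterior Omega) kappa psi f -> 0 < delta < 1 ->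
  f11_estimate kappa k w alpha psi f (half_sphere_lt w delta).
Proof.
move=> d2 oO bO w1 kE kappa0 a0 /eqP sina psiC eqn far delta01.
have [C [R0 [C0 R01 _ amp]]] := far_field_amplitude oO bO far.
have [K K0 f_lip] := far_field_regular d2 oO bO psiC eqn far.
have [L [r1 [L0 [r10 shift]]]] := shift_asymptotics k w1 kappa0 a0 delta01.
have [M M0 fM] : exists2 M : R, 0 <= M & forall th, sphere th -> `|f th| <= M%:C.
  exists (Num.sqrt (complex.Re (f w) ^+ 2 + complex.Im (f w) ^+ 2) + K * 2).
    by rewrite addr_ge0 ?sqrtr_ge0 ?mulr_ge0.
  move=> th th1; apply: (@le_trans _ _ (`|f w| + (K * 2)%:C)); last first.
    by rewrite normc_def -(rmorphD (real_complex R)).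
  rewrite -[f th](subrK (f w)) addrC.
  rewrite (le_trans (ler_normD _ _))// lerD// (le_trans (f_lip _ _ th1 w1))// lecR.
  rewrite ler_wpM2l// (le_trans (ler_enormD _ _))// enormN [enorm th]th1 [enorm w]w1.
  by lra.
pose C1 := 2 * C + (M + C) ^+ 2.
have C10 : 0 <= C1 by apply: addr_ge0; [exact: mulr_ge0|exact: sqr_ge0].
(* [C1] comes from the expansion at [x], [2 * C1] from that at [y], whose norm is at least r / 2,
   and [2 * (K * L)] from replacing [f (direction y)] and its conjugate by their values at [th]. *)
pose B := 3 * C1 + 2 * (K * L).
have sa0 : 0 < `|sin alpha| by rewrite normr_gt0.
(* The three thresholds ensure [R0 <= enorm y], the validity of the shift asymptotics, and a phase
   error of at most half of [|sin alpha|]. The factor 2 is the bound on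
   [|sin alpha| / |sin phi|]. *)
exists (2 * B), (Num.max (2 * R0) (Num.max r1 ((2 * L / `|sin alpha|) ^+ 2))).
split=> [|th r zeta zetah beta [[th1 thw] thd]].
  by rewrite lt_max mulr_gt0// (lt_le_trans ltr01).
rewrite !ge_max => /and3P[rR0 rr1 rL] sc.
have r2 : 2 <= r by apply: le_trans rR0; rewrite ler_peMr.
have r0 : 0 < r by apply: lt_le_trans r2.
set x := r *: th; set y := x + zeta.
have [y1 y2 y3] := shift th r zeta zetah beta th1 thd rr1 sc; rewrite -/x -/y in y1 y2 y3.
have xr : enorm x = r by rewrite enormZ_sphere// ltW.
have xth : direction x = th by exact: direction_ray.
have yR0 : R0 <= enorm y by apply: le_trans y1; rewrite ler_pdivlMr// mulrC.
have y10 : 1 <= enorm y := le_trans R01 yR0.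
have yth : sphere (direction y).
  apply: enorm_direction; apply: contraTneq y10 => ->.
  by rewrite /enorm dot0l sqrtr0 -ltNge.
set s := Num.sqrt r in y2 y3.
have s0 : 0 < s by rewrite sqrtr_gt0.
have s2 : s ^+ 2 = r by rewrite sqr_sqrtr// ltW.
have sL : L / s <= `|sin alpha| / 2.
  have t0 : 0 <= 2 * L / `|sin alpha| by rewrite divr_ge0 ?mulr_ge0.
  have : 2 * L / `|sin alpha| <= s.
    by rewrite -(@ler_pXn2r _ 2)// ?s2// nnegrE ltW.
  by rewrite !ler_pdivrMr//; lra.
pose e1 := intensity psi k x -
  (cis (- phase k x) * f th + cis (phase k x) * (f th)^*%C).
pose e2 := intensity psi k y -
  (cis (- phase k y) * f th + cis (phase k y) * (f th)^*%C).
have e1B : `|e1| <= (C1 / s)%:C.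
  rewrite /s -xr; apply: intensity_expansion => //; rewrite ?xr; first lra.
    exact: fM.
  by have := amp x; rewrite kE xr xth; apply; lra.
have e2B : `|e2| <= ((2 * C1 + 2 * (K * L)) / s)%:C.
  pose e3 := intensity psi k y -
    (cis (- phase k y) * f (direction y) + cis (phase k y) * (f (direction y))^*%C).
  have e3B : `|e3| <= (2 * C1 / s)%:C.
    apply: (@le_trans _ _ (C1 / Num.sqrt (enorm y))%:C).
      apply: intensity_expansion => //; first exact: fM.
      by rewrite kE; exact: amp.
    rewrite lecR -mulrA mulrCA ler_wpM2l//.
    rewrite -[leRHS]invrK lef_pV2 ?posrE ?invr_gt0 ?mulr_gt0 ?invr_gt0//; last first.
      by rewrite sqrtr_gt0 (lt_le_trans ltr01).
    rewrite invfM invrK -(@ler_pXn2r _ 2)// ?nnegrE ?sqrtr_ge0 ?mulr_ge0 ?invr_ge0//;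
      last exact: ltW.
    rewrite exprMn s2 sqr_sqrtr ?enorm_ge0//; lra.
  have fB : `|f (direction y) - f th| <= (K * L / s)%:C.
    by apply: le_trans (f_lip _ _ yth th1) _; rewrite lecR -mulrA ler_wpM2l.
  have -> : e2 = e3 + (cis (- phase k y) * (f (direction y) - f th) +
      cis (phase k y) * (f (direction y) - f th)^*%C).
    by rewrite /e2 /e3 (rmorphB conjc) /=; ring.
  rewrite (le_trans (ler_normD _ _))//.
  have -> : ((2 * C1 + 2 * (K * L)) / s)%:C =
      (2 * C1 / s)%:C + ((K * L / s)%:C + (K * L / s)%:C).
    by rewrite -!(rmorphD (real_complex R)); congr (_%:C); field; rewrite gt_eqF.
  rewrite lerD// (le_trans (ler_normD _ _))//.
  by rewrite (normrM (cis _)) (normrM (cis (phase _ _))) !norm_cis !mul1r normcJ lerD.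
have DE : two_point_det k x zeta =
    2 * 'i%C * (sin (dot k zeta + kappa * r - kappa * enorm y))%:C.
  by rewrite /two_point_det -/y kE xr.
set phi := dot k zeta + kappa * r - kappa * enorm y in y3 DE.
have sphi : `|sin alpha| / 2 <= `|sin phi|.
  have h1 := le_trans (ler_dist_sin phi alpha) (le_trans y3 sL).
  have := ler_normB (sin phi) (sin phi - sin alpha); rewrite opprB addrC subrK.
  by move: h1; lra.
have sphi0 : 0 < `|sin phi| by apply: lt_le_trans sphi; rewrite divr_gt0.
have nz (t : R) : 0 < `|t| -> 2 * 'i%C * t%:C != 0 :> R[i].
  move=> t0; rewrite -normr_gt0 norm_2i -(rmorph0 (real_complex R)) ltcR.
  by rewrite mulr_gt0.
(* The remainder is read off from the required equation, so only its bound has content. *)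
exists (2 * 'i%C * (sin alpha)%:C * (f th - f11 psi k x zeta)); split; last first.
  by rewrite mulrA mulVf ?nz// mul1r addrC subrK.
have D0 : two_point_det k x zeta != 0 by rewrite DE nz.
rewrite -[f th - _]opprB (f11_solves _ _ D0) -/y -/e1 -/e2.
rewrite (normrM (2 * 'i%C * _)) normrN (normrM (two_point_det _ _ _)^-1) normfV.
rewrite DE !norm_2i.
have num : `|cis (phase k y) * e1 - cis (phase k x) * e2| <= (B / s)%:C.
  rewrite (le_trans (ler_normB _ _))//.
  have -> : (B / s)%:C = (C1 / s)%:C + ((2 * C1 + 2 * (K * L)) / s)%:C.
    rewrite -(rmorphD (real_complex R)); congr (_%:C).
    by rewrite /B; field; rewrite gt_eqF.
  by rewrite (normrM (cis _)) (normrM (cis (phase k x))) !norm_cis !mul1r lerD.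
have B0 : 0 <= B by rewrite addr_ge0 ?mulr_ge0.
rewrite mulrA -(fmorphV (real_complex R)) -(rmorphM (real_complex R)).
apply: (@le_trans _ _ ((2 * `|sin alpha| * (2 * `|sin phi|)^-1)%:C * (B / s)%:C)).
  by rewrite ler_wpM2l// ler0c !mulr_ge0 ?invr_ge0 ?mulr_ge0.
rewrite -(rmorphM (real_complex R)) lecR.
have -> : r `^ (- (1 / 2)) = s^-1 by rewrite powRN mul1r powR12_sqrt// ltW.
rewrite -[leRHS]mulrA ler_wpM2r ?divr_ge0 ?(ltW s0)//.
by rewrite ler_pdivrMr ?mulr_gt0//; lra.
Qed.

End Estimate.

Theorem proposition2p5 (R : realType) (d : nat) (Omega : set 'rV[R]_d)
    (omega k : 'rV[R]_d) (kappa alpha : R) (psi1 f1 : 'rV[R]_d -> complex R)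
    (d_ge2 : (2 <= d)%N)
    (Omega_dom : smooth_bounded_domain Omega)
    (U_conn : connected (exterior Omega))
    (omega_sphere : sphere omega)
    (k_norm : enorm k = kappa) (kappa_gt0 : 0 < kappa)
    (alpha_lt0 : alpha < 0) (sin_alpha : sin alpha <> 0)
    (psi1_rad : radiation_solution (exterior Omega) kappa psi1)
    (f1_far : far_field_pattern (exterior Omega) kappa psi1 f1) :
  (forall theta, half_sphere omega theta ->
     f11_estimate kappa k omega alpha psi1 f1 [set theta]) /\
  (forall delta : R, 0 < delta < 1 ->
     f11_estimate kappa k omega alpha psi1 f1 (half_sphere_lt omega delta)).
Proof.
have [oO _ _ bO _] := Omega_dom; have [psiC eqn _] := psi1_rad.
have uniform delta : 0 < delta < 1 ->
    f11_estimate kappa k omega alpha psi1 f1 (half_sphere_lt omega delta).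
  by move=> delta01; apply: (@f11_estimate_uniform _ _ Omega).
split=> // theta th; have [th1 thw] := th.
pose e := enorm (par_part omega theta).
have e1 : e < 1.
  rewrite -(@ltr_pXn2r _ 2)// ?nnegrE ?enorm_ge0// expr1n sqr_enorm_par_part//.
  by rewrite ltrBlDr ltrDl exprn_gt0.
have e0 : 0 <= e by exact: enorm_ge0.
(* A fixed [theta] in the open half sphere has parallel part shorter than 1; the midpoint is a
   [delta] whose cap contains it. *)
have delta01 : 0 < (1 + e) / 2 < 1 by lra.
have [c [r0 [r00 est]]] := uniform _ delta01; exists c, r0; split=> //.
move=> _ r zeta zetah beta -> rr0 sc; apply: est sc => //; split=> //.
by rewrite -/e; lra.
Qed.
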